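(* Let $\Sigma$ be an oriented surface. Any reduced alternating link diagram on $\Sigma$ is adequate.
   Context: $\Sigma$ is an oriented surface with one or more connected components, possibly with boundary. A link diagram $D$ on $\Sigma$ is alternating if, when traveling (once around) along any of its components, its crossings alternate between over and under. A crossing $x$ of $D$ is nugatory if there is a simple loop in $\Sigma$ which separates $\Sigma$ and intersects $D$ only at $x$ (the loop passing through $x$ between opposite local regions). A nugatory crossing is removable if this simple loop can be chosen to bound a disk in $\Sigma$. $D$ is reduced if it has no removable nugatory crossings. Each crossing of $D$ has an $A$-smoothing (which joins the two local regions swept out when the overstrand is rotated counterclockwise until it meets the understrand) and a $B$-smoothing (which joins the other two local regions). A state $S$ of $D$ is a choice of smoothing at each crossing; it is identified with the resulting collection of pairwise disjoint simple loops on $\Sigma$. $S_A$ and $S_B$ are the states with all $A$-smoothings, respectively all $B$-smoothings. Two states are adjacent if they differ at exactly one crossing. $t(S)$ is the number of contractible loops of $S$, and $\widehat S$ is $S$ with its contractible loops removed, regarded as an element of $\mathcal{MC}(\Sigma)$, the set of isotopy classes of collections (possibly empty) of pairwise disjoint, non-contractible, unoriented simple loops on $\Sigma$. $D$ is $A$-adequate if for every state $S$ adjacent to $S_A$ one has $t(S)\le t(S_A)$ or $\widehat S\ne\widehat S_A$ in $\mathcal{MC}(\Sigma)$. $D$ is $B$-adequate if for every state $S$ adjacent to $S_B$ one has $t(S)\le t(S_B)$ or $\widehat S\ne\widehat S_B$. $D$ is adequate (skein adequate) if it is both $A$- and $B$-adequate. *)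

(* Defs.v *)
From mathcomp Require Export all_boot all_order all_algebra.
From mathcomp Require Export all_classical all_reals all_analysis.

Set Implicit Arguments.
Unset Strict Implicit.
Unset Printing Implicit Defensive.

Export Order.TTheory GRing.Theory Num.Theory.
Export numFieldNormedType.Exports.

Global Open Scope classical_set_scope.
Global Open Scope ring_scope.

Definition open_embedding (X Y : topologicalType) (V : set X) (f : X -> Y) :=
  [/\ {within V, continuous f},
      {in V &, injective f} &
      forall O : set X, open O -> open (f @` (V `&` O))].

Definition half_plane (R : realType) : set (R * R) := [set p | 0 <= p.2].
Arguments half_plane R : clear implicits.

Definition interior_point (R : realType) (T : topologicalType) (p : T) :=
  exists2 f : R * R -> T, open_embedding setT f & range f p.

Definition boundary_chart_point (R : realType) (T : topologicalType) (p : T) :=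
  exists2 f : R * R -> T,
    open_embedding (half_plane R) f & (f @` half_plane R) p.

Definition closed_disc (R : realType) (c : R * R) (r : R) : set (R * R) :=
  [set p | (p.1 - c.1) ^+ 2 + (p.2 - c.2) ^+ 2 <= r ^+ 2].

Definition open_disc (R : realType) (c : R * R) (r : R) : set (R * R) :=
  [set p | (p.1 - c.1) ^+ 2 + (p.2 - c.2) ^+ 2 < r ^+ 2].

Definition circle (R : realType) (c : R * R) (r : R) : set (R * R) :=
  [set p | (p.1 - c.1) ^+ 2 + (p.2 - c.2) ^+ 2 = r ^+ 2].

Definition polar (R : realType) (c : R * R) (rho theta : R) : R * R :=
  (c.1 + rho * cos theta, c.2 + rho * sin theta).

(* For f a local homeomorphism on the open set V, g an open embedding of the
   plane and f p = g q, this says that the transition map g^-1 \o f preserves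
   orientation near p: the image under it of a small counterclockwise circle
   around p has winding number 1 around q. The winding number is read off a
   continuous choice theta of the polar angle. *)
Definition cooriented (R : realType) (T : topologicalType) (V : set (R * R))
    (f : R * R -> T) (p : R * R) (g : R * R -> T) (q : R * R) :=
  f p = g q /\
  exists r : R, [/\ 0 < r, closed_disc p r `<=` V,
    f @` closed_disc p r `<=` range g &
    exists rho theta : R -> R, [/\ continuous rho, continuous theta,
      forall t, 0 < rho t,
      forall t, f (polar p r t) = g (polar q (rho t) (theta t)) &
      theta (2 * pi) = theta 0 + 2 * pi]].

(* A topological surface, possibly disconnected, noncompact or with boundary.
   The orientation is an atlas of the interior whose transition maps preserve
   the standard orientation of the plane. *)
Record oriented_surface (R : realType) := OrientedSurface {
  surface_space :> topologicalType;
  surface_hausdorff : hausdorff_space surface_space;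
  surface_second_countable : @second_countable surface_space;
  surface_charts : forall p : surface_space,
    interior_point R p \/ boundary_chart_point R p;
  atlas : set (R * R -> surface_space);
  atlas_embedding : forall f, atlas f -> open_embedding setT f;
  atlas_cover : forall p : surface_space,
    interior_point R p -> exists2 f, atlas f & range f p;
  atlas_cooriented : forall f g p q, atlas f -> atlas g -> f p = g q ->
    cooriented setT f p g q }.

Inductive strand := Over | Under.

Inductive smoothing := ASmoothing | BSmoothing.

Definition strip (R : realType) : set (R * R) := [set p | `|p.2| < 1].
Arguments strip R : clear implicits.

(* On component i, the time s is that of the passage l of the crossing x,
   plus a, up to a multiple of the period. *)
Definition at_offset (R : realType) (n : nat) (X : finType) (period : 'I_n -> R)
    (passage : X -> strand -> 'I_n * R)
    (i : 'I_n) (s : R) (x : X) (l : strand) (a : R) :=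
  i = (passage x l).1 /\
  exists k : int, s = (passage x l).2 + a + k%:~R * period i.

(* A link diagram is given together with a regular neighbourhood in normal form
   (every diagram has one). Component i is the closed curve
   s |-> ribbon i (s, 0), of period [period i], and [ribbon i], restricted to
   the strip |u| < 1, is an orientation-preserving immersed band around it.
   Crossing x is traversed by its over and under strand at the parameters
   [passage x Over] and [passage x Under] (component, time). The unit squares
   of the two bands centred there are the same square of the surface, a quarter
   turn apart; the direction of the turn ([crossing_sign x]) tells in which of
   the two directions the understrand crosses the overstrand. There are no other
   coincidences. *)
Record link_diagram (R : realType) (Sigma : oriented_surface R) := LinkDiagram {
  ncomp : nat;
  period : 'I_ncomp -> R;
  ribbon : 'I_ncomp -> R * R -> Sigma;
  crossing : finType;
  passage : crossing -> strand -> 'I_ncomp * R;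
  crossing_sign : crossing -> bool;
  period_gt0 : forall i, 0 < period i;
  ribbon_periodic : forall i s u,
    strip R (s, u) -> ribbon i (s + period i, u) = ribbon i (s, u);
  ribbon_continuous : forall i, {within strip R, continuous (ribbon i)};
  ribbon_open : forall i (O : set (R * R)),
    open O -> O `<=` strip R -> open (ribbon i @` O);
  ribbon_oriented : forall i p, strip R p ->
    exists2 f, atlas f & exists q, cooriented (strip R) (ribbon i) p f q;
  passages_disjoint : forall i s x l a y m b,
    `|a| < 1 -> `|b| < 1 ->
    at_offset period passage i s x l a -> at_offset period passage i s y m b ->
    [/\ x = y, l = m & a = b];
  ribbon_crossing : forall x a b, `|a| < 1 -> `|b| < 1 ->
    ribbon (passage x Over).1 ((passage x Over).2 + a, b) =
    ribbon (passage x Under).1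
      ((passage x Under).2 + (-1) ^+ crossing_sign x * b,
       - ((-1) ^+ crossing_sign x * a));
  ribbon_injective : forall i j s u s' u',
    strip R (s, u) -> strip R (s', u') -> ribbon i (s, u) = ribbon j (s', u') ->
    [/\ i = j, u = u' & exists k : int, s' = s + k%:~R * period i] \/
    exists x l m, [/\ l <> m,
      exists2 a, `|a| < 1 & at_offset period passage i s x l a &
      exists2 b, `|b| < 1 & at_offset period passage j s' x m b] }.

Arguments ribbon {R Sigma} D i p : rename.
Arguments period {R Sigma} D i : rename.
Arguments passage {R Sigma} D x l : rename.

Definition diagram_curve (R : realType) (Sigma : oriented_surface R)
    (D : link_diagram Sigma) : set Sigma :=
  [set p | exists i s, p = ribbon D i (s, 0)].

(* Positive coordinates centred at the crossing x: the overstrand is the first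
   axis, the understrand the second one. *)
Definition crossing_chart (R : realType) (Sigma : oriented_surface R)
    (D : link_diagram Sigma) (x : crossing D) (p : R * R) : Sigma :=
  ribbon D (passage D x Over).1 ((passage D x Over).2 + p.1, p.2).

Definition crossing_point (R : realType) (Sigma : oriented_surface R)
    (D : link_diagram Sigma) (x : crossing D) : Sigma :=
  crossing_chart x (0, 0).

Definition local_region (R : realType) (Sigma : oriented_surface R)
    (D : link_diagram Sigma) (x : crossing D) (e1 e2 : bool) : set Sigma :=
  crossing_chart x @`
    [set p | 0 < (-1) ^+ e1 * p.1 < 1 /\ 0 < (-1) ^+ e2 * p.2 < 1].

Definition passes_at (R : realType) (Sigma : oriented_surface R)
    (D : link_diagram Sigma) (i : 'I_(ncomp D)) (s : R) (l : strand) :=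
  exists x : crossing D, at_offset (period D) (passage D) i s x l 0.

(* Two passages met successively in one trip around a component, from any
   starting point, are of different kinds. *)
Definition alternating (R : realType) (Sigma : oriented_surface R)
    (D : link_diagram Sigma) :=
  forall (i : 'I_(ncomp D)) (s s' : R) (l l' : strand),
    s < s' < s + period D i -> passes_at i s l -> passes_at i s' l' ->
    (forall (r : R) (m : strand), s < r < s' -> ~ passes_at i r m) ->
    l <> l'.

Definition simple_loop (R : realType) (T : topologicalType) (c : R -> T) :=
  [/\ continuous c, forall t, c (t + 1) = c t &
      {in `[0, 1[%classic &, injective c}].

Definition separates (T : topologicalType) (L : set T) :=
  exists p q, [/\ ~ L p, ~ L q, connected_component setT p q &
    ~ connected_component (~` L) p q].

(* The openness clause is automatic, by invariance of domain, when T is a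
   surface. *)
Definition bounds_disc (R : realType) (T : topologicalType) (L : set T) :=
  exists e : R * R -> T,
    [/\ {within closed_disc (0, 0) 1, continuous e},
        {in closed_disc (0, 0) 1 &, injective e},
        e @` circle (0, 0) 1 = L &
        open (e @` open_disc (0, 0) 1)].

Definition crosses_between_opposite_regions (R : realType)
    (Sigma : oriented_surface R) (D : link_diagram Sigma) (x : crossing D)
    (c : R -> Sigma) :=
  c 0 = crossing_point x /\
  exists (e1 e2 : bool) (delta : R), [/\ 0 < delta,
    forall t, - delta < t < 0 -> local_region x e1 e2 (c t) &
    forall t, 0 < t < delta -> local_region x (~~ e1) (~~ e2) (c t)].

Definition nugatory_loop (R : realType) (Sigma : oriented_surface R)
    (D : link_diagram Sigma) (x : crossing D) (c : R -> Sigma) :=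
  [/\ simple_loop c, separates (range c),
      range c `&` diagram_curve D = [set crossing_point x] &
      crosses_between_opposite_regions x c].

Definition nugatory (R : realType) (Sigma : oriented_surface R)
    (D : link_diagram Sigma) (x : crossing D) :=
  exists c : R -> Sigma, nugatory_loop x c.

Definition removable (R : realType) (Sigma : oriented_surface R)
    (D : link_diagram Sigma) (x : crossing D) :=
  exists2 c : R -> Sigma, nugatory_loop x c & bounds_disc R (range c).

Definition reduced (R : realType) (Sigma : oriented_surface R)
    (D : link_diagram Sigma) :=
  forall x : crossing D, ~ removable x.

Definition state (R : realType) (Sigma : oriented_surface R)
    (D : link_diagram Sigma) := crossing D -> smoothing.

Definition state_A (R : realType) (Sigma : oriented_surface R)
    (D : link_diagram Sigma) : state D := fun=> ASmoothing.

Definition state_B (R : realType) (Sigma : oriented_surface R)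
    (D : link_diagram Sigma) : state D := fun=> BSmoothing.

Definition adjacent (R : realType) (Sigma : oriented_surface R)
    (D : link_diagram Sigma) (S S' : state D) :=
  exists2 x, S x <> S' x & forall y, y <> x -> S y = S' y.

(* Turning the overstrand (first axis) counterclockwise onto the understrand
   sweeps the quadrants p.1 * p.2 > 0, so the arcs of the A-smoothing run in
   the two other quadrants. *)
Definition smoothing_arcs (R : realType) (Sigma : oriented_surface R)
    (D : link_diagram Sigma) (x : crossing D) (m : smoothing) : set Sigma :=
  crossing_chart x @`
    [set p | `|p.1| + `|p.2| = 2^-1 /\
             match m with
             | ASmoothing => p.1 * p.2 <= 0
             | BSmoothing => 0 <= p.1 * p.2
             end].

Definition state_curve (R : realType) (Sigma : oriented_surface R)
    (D : link_diagram Sigma) (S : state D) : set Sigma :=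
  (diagram_curve D `\`
     \bigcup_(x in [set: crossing D])
       (crossing_chart x @` [set p | `|p.1| + `|p.2| < 2^-1]))
  `|` \bigcup_(x in [set: crossing D]) smoothing_arcs x (S x).

Definition loops (R : realType) (Sigma : oriented_surface R)
    (D : link_diagram Sigma) (S : state D) : set (set Sigma) :=
  connected_component (state_curve S) @` state_curve S.

(* For a simple loop on a surface, contractible is taken in the usual sense of
   skein theory: the loop bounds an embedded disc. *)
Definition contractible_loops (R : realType) (Sigma : oriented_surface R)
    (D : link_diagram Sigma) (S : state D) : set (set Sigma) :=
  loops S `&` [set L | bounds_disc R L].

Definition noncontractible_loops (R : realType) (Sigma : oriented_surface R)
    (D : link_diagram Sigma) (S : state D) : set (set Sigma) :=
  loops S `\` [set L | bounds_disc R L].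

(* Equality of the classes of two families of loops in MC(T): some ambient
   isotopy carries one family onto the other. *)
Definition isotopic (R : realType) (T : topologicalType) (C C' : set (set T)) :=
  exists H : R -> T -> T,
    [/\ continuous (fun p : R * T => H p.1 p.2),
        forall t, exists g : T -> T,
          [/\ cancel (H t) g, cancel g (H t) & continuous g],
        forall p, H 0 p = p &
        [set H 1 @` L | L in C] = C'].

(* [#<=] compares the (finite) numbers of contractible loops. *)
Definition adequate_at (R : realType) (Sigma : oriented_surface R)
    (D : link_diagram Sigma) (S0 : state D) :=
  forall S : state D, adjacent S0 S ->
    (contractible_loops S #<= contractible_loops S0)%card \/
    ~ isotopic R (noncontractible_loops S) (noncontractible_loops S0).

Definition A_adequate (R : realType) (Sigma : oriented_surface R)
    (D : link_diagram Sigma) := adequate_at (@state_A R Sigma D).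

Definition B_adequate (R : realType) (Sigma : oriented_surface R)
    (D : link_diagram Sigma) := adequate_at (@state_B R Sigma D).

Definition adequate (R : realType) (Sigma : oriented_surface R)
    (D : link_diagram Sigma) := A_adequate D /\ B_adequate D.

(* Main.v *)
(* Suppose that switching the smoothing at a crossing x of the state S_m
   creates a contractible loop without changing the isotopy class of the
   noncontractible ones. Counting loops, one sees that x must lie on two
   distinct loops of the new state S, one of which, L, bounds a disc. Since the
   diagram alternates, the smoothing arcs of S_m at both ends of an edge lie on
   the same side of that edge, so a homeomorphism of the surface pushes the
   edges of L off the diagram, towards that side; near x a further push moves
   the arc of L onto a path crossing x between opposite regions. The image of L
   still bounds a disc and meets the diagram at x only, hence x is removable.

   The argument fails for an edge whose two ends are the same passage, which is
   the only case where alternation gives nothing. But L cannot run along such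
   an edge: the two sides of L near the edge would be joined by a path that
   avoids L, following the component once around, whereas a disc lies on one
   side only of its boundary. The latter is a form of invariance of domain: a
   small circle around a boundary point would be contractible in the disc minus
   that point, which is excluded by lifting the angle along the contraction. *)

Require Import Defs.
From mathcomp Require finmap.
From mathcomp Require Import ring lra.

Set Implicit Arguments.
Unset Strict Implicit.
Unset Printing Implicit Defensive.

(** * Continuity and open embeddings *)

(** Discs are only transported, never constructed: every push is a homeomorphism of the whole
    surface, the identity outside a chart and an explicit map of the plane inside. The image of a
    loop is then again simple and bounds a disc, and what remains to check is which points land on
    the diagram.

    The sides of an edge are compared through one sign. In the square of a crossing, the arcs of a
    smoothing lie in two opposite quadrants, told by the sign of the product of the coordinates, and
    the quarter turn from the coordinates of one strand to those of the other reverses this sign.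
    From one end of an edge to the other the offset from the crossing changes sign, and by
    alternation so does the strand; the two changes cancel.

    Loops are connected components of a subset of the surface, not parametrized curves. To compare
    adjacent states, their curves are cut into finitely many closed connected pieces, common to both
    states except for the arcs at [x]; a parametrization is chosen only at the end, from the
    boundary of the disc. *)

Section Continuity.
Variable R : realType.

Lemma cont_comp (X Y Z : topologicalType) (g : Y -> Z) (f : X -> Y) :
  continuous g -> continuous f -> continuous (fun x => g (f x)).
Proof. by move=> cg cf x; apply: (@continuous_comp _ _ _ f g); [exact: cf|exact: cg]. Qed.

Lemma cont_pair (X Y Z : topologicalType) (f : X -> Y) (g : X -> Z) :
  continuous f -> continuous g -> continuous (fun x => (f x, g x)).
Proof. by move=> cf cg x; apply: cvg_pair; [exact: cf|exact: cg]. Qed.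

Lemma cont_fst (X Y Z : topologicalType) (f : X -> Y * Z) :
  continuous f -> continuous (fun x => (f x).1).
Proof. by move=> cf; apply: cont_comp cf => y; exact: cvg_fst. Qed.

Lemma cont_snd (X Y Z : topologicalType) (f : X -> Y * Z) :
  continuous f -> continuous (fun x => (f x).2).
Proof. by move=> cf; apply: cont_comp cf => y; exact: cvg_snd. Qed.

Lemma cont_cst (X Y : topologicalType) (y : Y) : continuous (fun _ : X => y).
Proof. by move=> x; exact: cvg_cst. Qed.

Lemma cont_id (X : topologicalType) : continuous (fun x : X => x).
Proof. by move=> x; exact: cvg_id. Qed.

Variables (X : topologicalType) (f g : X -> R).
Hypotheses (cf : continuous f) (cg : continuous g).

Lemma contD : continuous (fun x => f x + g x).
Proof. by move=> x; apply: cvgD; [exact: cf|exact: cg]. Qed.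

Lemma contM : continuous (fun x => f x * g x).
Proof. by move=> x; apply: cvgM; [exact: cf|exact: cg]. Qed.

Lemma contN : continuous (fun x => - f x).
Proof. by move=> x; apply: cvgN; exact: cf. Qed.

Lemma contX n : continuous (fun x => f x ^+ n).
Proof.
by move=> x; apply: (@continuous_comp _ _ _ f (fun y => y ^+ n));
  [exact: cf|exact: exprn_continuous].
Qed.

Lemma cont_norm : continuous (fun x => `|f x|).
Proof. by move=> x; apply: cvg_norm; exact: cf. Qed.

Lemma cont_max : continuous (fun x => Num.max (f x) (g x)).
Proof. exact: max_fun_continuous. Qed.

Lemma cont_min : continuous (fun x => Num.min (f x) (g x)).
Proof. exact: min_fun_continuous. Qed.

Lemma cont_cos : continuous (fun x => cos (f x)).
Proof. by apply: cont_comp => //; exact: continuous_cos. Qed.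

Lemma cont_sin : continuous (fun x => sin (f x)).
Proof. by apply: cont_comp => //; exact: continuous_sin. Qed.

End Continuity.

Ltac cont := repeat lazymatch goal with
  | |- continuous (fun _ => ?c) => exact: cont_cst
  | |- continuous (fun x => x) => exact: cont_id
  | |- continuous (fun x => (@?f x, @?g x)) => apply: (@cont_pair _ _ _ f g)
  | |- continuous (fun x => (@?f x).1) => apply: (@cont_fst _ _ _ f)
  | |- continuous (fun x => (@?f x).2) => apply: (@cont_snd _ _ _ f)
  | |- continuous (fun x => @?f x + @?g x) => apply: (@contD _ _ f g)
  | |- continuous (fun x => - @?f x) => apply: (@contN _ _ f)
  | |- continuous (fun x => @?f x * @?g x) => apply: (@contM _ _ f g)
  | |- continuous (fun x => @?f x ^+ ?n) => apply: (@contX _ _ f _ n)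
  | |- continuous (fun x => `|@?f x|) => apply: (@cont_norm _ _ f)
  | |- continuous (fun x => Num.max (@?f x) (@?g x)) => apply: (@cont_max _ _ f g)
  | |- continuous (fun x => Num.min (@?f x) (@?g x)) => apply: (@cont_min _ _ f g)
  | |- continuous (fun x => cos (@?f x)) => apply: (@cont_cos _ _ f)
  | |- continuous (fun x => sin (@?f x)) => apply: (@cont_sin _ _ f)
  | |- continuous (pair ?c) => exact: (cont_pair (@cont_cst _ _ c) (@cont_id _))
  | |- continuous fst => exact: (cont_fst (@cont_id _))
  | |- continuous snd => exact: (cont_snd (@cont_id _))
  | |- _ => assumption
  end.

Lemma open_lt_cont (R : realType) (X : topologicalType) (f g : X -> R) :
  continuous f -> continuous g -> open [set x | f x < g x].
Proof.
move=> cf cg; have h : continuous (fun x => g x - f x) by cont.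
rewrite (_ : [set x | _] = (fun x => g x - f x) @^-1` [set y | 0 < y]).
  by move/continuousP : h; apply; exact: open_gt.
by apply/seteqP; split => x /=; rewrite subr_gt0.
Qed.

Lemma closed_le_cont (R : realType) (X : topologicalType) (f g : X -> R) :
  continuous f -> continuous g -> closed [set x | f x <= g x].
Proof.
move=> cf cg; have h : continuous (fun x => g x - f x) by cont.
rewrite (_ : [set x | _] = (fun x => g x - f x) @^-1` [set y | 0 <= y]).
  by move/continuous_closedP : h; apply; exact: closed_ge.
by apply/seteqP; split => x /=; rewrite subr_ge0.
Qed.

Lemma within_nbhs (X Y : topologicalType) (A : set X) (f : X -> Y) x (W : set Y) :
  {within A, continuous f} -> A x -> nbhs (f x) W ->
  nbhs x [set y | A y -> W (f y)].
Proof. by move=> /subspace_continuousP cf Ax /(cf _ Ax). Qed.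

Lemma within_nbhsP (X Y : topologicalType) (A : set X) (f : X -> Y) :
  (forall x W, A x -> nbhs (f x) W -> nbhs x [set y | A y -> W (f y)]) ->
  {within A, continuous f}.
Proof. by move=> h; apply/subspace_continuousP => x Ax W /(h _ _ Ax). Qed.

Lemma embedding_nbhs (X Y : topologicalType) (V : set X) (f : X -> Y) p (M : set X) :
  open_embedding V f -> V p -> nbhs p M -> nbhs (f p) (f @` (V `&` M)).
Proof.
move=> [_ _ fo] Vp; rewrite nbhsE => -[U [Uo Up] UM].
apply: (@filterS _ _ _ (f @` (V `&` U))).
  by apply: image_subset; exact: setIS.
by apply: open_nbhs_nbhs; split; [exact: fo|exists p].
Qed.

Lemma embedding_nbhsT (X Y : topologicalType) (V : set X) (f : X -> Y) p :
  open_embedding V f -> V p -> nbhs (f p) (f @` V).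
Proof.
move=> fe Vp; rewrite -[X in f @` X]setIT; apply: embedding_nbhs => //.
exact: filterT.
Qed.

Lemma embedding_nbhs_inj (X Y : topologicalType) (V : set X) (f : X -> Y) p (M : set X) :
  open_embedding V f -> V p -> nbhs p M ->
  exists2 W, nbhs (f p) W & forall q, V q -> W (f q) -> M q.
Proof.
move=> fe Vp Mp; exists (f @` (V `&` M)); first exact: embedding_nbhs.
move=> q Vq [q' [Vq' Mq'] fqq]; case: fe => _ fi _.
by have := fi q' q; rewrite !inE => /(_ Vq' Vq fqq) <-.
Qed.

(** * Winding of plane curves *)

Section Winding.
Variable R : realType.
Implicit Types (p q : R * R) (t r a b : R).

Definition dotp p q := p.1 * q.1 + p.2 * q.2.
Definition crossp p q := p.1 * q.2 - p.2 * q.1.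

Definition has_angle p a := exists2 r, 0 < r & p = (r * cos a, r * sin a).

Lemma has_angle_step p q a : has_angle p a -> 0 < dotp p q ->
  has_angle q (a + atan (crossp p q / dotp p q)).
Proof.
move=> [r r0 ->] d0; set d := dotp _ q in d0 *; set c := crossp _ q.
set b := atan _.
have cb0 : 0 < cos b.
  by apply: cos_gt0_pihalf; rewrite atan_gtNpi2 atan_ltpi2.
have sb : sin b = c / d * cos b.
  by rewrite -[c / d]atanK -/b /tan divfK ?gt_eqF.
exists (d / (r * cos b)); first by rewrite divr_gt0 ?mulr_gt0.
have cs := cos2Dsin2 a.
have e1 : r * q.1 = d * cos a - sin a * c.
  by rewrite /d /c /dotp /crossp /= -[LHS]mulr1 -cs; ring.
have e2 : r * q.2 = d * sin a + cos a * c.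
  by rewrite /d /c /dotp /crossp /= -[LHS]mulr1 -cs; ring.
rewrite cosD sinD sb; clearbody b d c.
have dn : d != 0 by rewrite gt_eqF.
have rn : r != 0 by rewrite gt_eqF.
have cn : cos b != 0 by rewrite gt_eqF.
rewrite [LHS]surjective_pairing; congr pair.
- by apply: (mulfI rn); rewrite e1; field; rewrite dn rn cn.
- by apply: (mulfI rn); rewrite e2; field; rewrite dn rn cn.
Qed.

Lemma has_angle_cos p a b : has_angle p a -> has_angle p b -> cos (a - b) = 1.
Proof.
move=> [r r0 ->] [r' r'0 [e1 e2]].
have ca := cos2Dsin2 a; have cb := cos2Dsin2 b.
have rr : r = r'.
  apply/eqP; rewrite -(@eqrXn2 _ 2) ?ltW//; apply/eqP.
  rewrite -[LHS]mulr1 -ca mulrDr -!exprMn e1 e2 !exprMn -mulrDr cb mulr1//.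
rewrite -rr in e1 e2.
have rn : r != 0 by rewrite gt_eqF.
by rewrite cosB (mulfI rn e1) (mulfI rn e2) -!expr2.
Qed.

Lemma continuous_dotp (T : topologicalType) (f g : T -> R * R) :
  continuous f -> continuous g -> continuous (fun x => dotp (f x) (g x)).
Proof. by move=> cf cg; rewrite /dotp; cont. Qed.

Lemma continuous_crossp (T : topologicalType) (f g : T -> R * R) :
  continuous f -> continuous g -> continuous (fun x => crossp (f x) (g x)).
Proof. by move=> cf cg; rewrite /crossp; cont. Qed.

Lemma dotpp_gt0 p : p <> (0, 0) -> 0 < dotp p p.
Proof.
move=> p0; rewrite lt_neqAle addr_ge0 ?andbT -?expr2 ?sqr_ge0//.
apply/negP => /eqP/esym/eqP; rewrite /dotp paddr_eq0 -?expr2 ?sqr_ge0//.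
rewrite !sqrf_eq0 => /andP[/eqP a /eqP b]; apply: p0.
by rewrite [LHS]surjective_pairing a b.
Qed.

(** Uniform continuity on a compact rectangle, in the form needed by [has_angle_step]: each of the
    curves at the stages k/(n+1) makes acute angles with the next one. *)
Lemma homotopy_small_steps (F : R * R -> R * R) (T : R) : continuous F ->
  (forall p, F p <> (0, 0)) ->
  exists n : nat, forall k t, (k <= n)%N -> 0 <= t <= T ->
    0 < dotp (F (k%:R / n.+1%:R, t)) (F (k.+1%:R / n.+1%:R, t)).
Proof.
move=> cF F0.
have /compact_near_coveringP cK : compact (`[0, 1]%classic `*` `[0, T]%classic : set (R * R)).
  by apply: compact_setX; exact: segment_compact.
pose P (d : R) (x : R * R) := forall r, `|x.1 - r| <= d -> 0 < dotp (F x) (F (r, x.2)).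
have /cK nd : forall x : R * R, (`[0, 1]%classic `*` `[0, T]%classic) x ->
    \forall x' \near x & d \near (0 : R)^'+, P d x'.
  move=> x _.
  pose G (y : (R * R) * R) := dotp (F y.1) (F (y.2, y.1.2)).
  have cG : continuous G.
    by apply: continuous_dotp; apply: cont_comp => //; cont.
  have Gx : 0 < G (x, x.1) by rewrite /G /= -surjective_pairing; exact: dotpp_gt0.
  have /nbhs_ballP[e /= e0 be] : nbhs (x, x.1) [set y | 0 < G y].
    exact: cvgr_gt _ (cG (x, x.1)) _ Gx.
  exists (ball x (e / 2), [set d | d < e / 2]) => /=.
    split; first by apply: nbhsx_ballx; rewrite divr_gt0.
    by apply: nbhs_right_lt; rewrite divr_gt0.
  move=> [x' d] [/= xx' de] r xr.
  apply: (be (x', r)); split => /=.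
    by apply: le_ball xx'; lra.
  rewrite /ball /=; case: xx'; rewrite /ball /= => h _.
  have -> : x.1 - r = (x.1 - x'.1) + (x'.1 - r) by ring.
  by apply: (le_lt_trans (ler_normD _ _)); lra.
have [d [d0 Pd]] : exists d, 0 < d /\ `[0, 1]%classic `*` `[0, T]%classic `<=` P d.
  near (0 : R)^'+ => d; exists d; split; near: d => //; exact: nbhs_right_gt.
have [n nd1] : exists n : nat, n.+1%:R^-1 < d.
  by have [n _ h] := near_infty_natSinv_lt (PosNum d0); exists n; apply: h => /=.
exists n => k t kn tT.
apply: (Pd (k%:R / n.+1%:R, t)).
  split => /=; rewrite in_itv //=.
  by rewrite divr_ge0//= ler_pdivrMr// mul1r ler_nat (leq_trans kn).
rewrite /= -mulrBl -opprB -natrB// subSnn mulN1r normrN gtr0_norm ?invr_gt0//.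
exact: ltW.
Unshelve. all: by end_near. Qed.

(** The angle is lifted by hand: at stage [k] it is [t] plus a sum [th k t] of arctangents, which
    takes the same value at 0 and 2 pi. At the last stage the curve is constant although this angle
    grows by 2 pi. *)
Lemma circle_not_nullhomotopic (F : R * R -> R * R) (r : R) : 0 < r ->
  continuous F -> (forall p, F p <> (0, 0)) ->
  (forall t, 0 <= t <= pi *+ 2 -> F (0, t) = (r * cos t, r * sin t)) ->
  (forall t, 0 <= t <= pi *+ 2 -> F (1, t) = F (1, 0)) ->
  (forall s, F (s, pi *+ 2) = F (s, 0)) -> False.
Proof.
move=> r0 cF F0 F_0 F_1 Fper.
have [n hn] := homotopy_small_steps (pi *+ 2) cF F0.
pose st k t := atan (crossp (F (k%:R / n.+1%:R, t)) (F (k.+1%:R / n.+1%:R, t)) /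
  dotp (F (k%:R / n.+1%:R, t)) (F (k.+1%:R / n.+1%:R, t))).
pose th k t := \sum_(j < k) st j t.
have p2 : 0 <= pi *+ 2 :> R by rewrite mulrn_wge0 ?pi_ge0.
have ang k t : (k <= n.+1)%N -> 0 <= t <= pi *+ 2 ->
    has_angle (F (k%:R / n.+1%:R, t)) (t + th k t).
  move=> + tT; elim: k => [_|k IH kn].
    by rewrite /th big_ord0 addr0 mul0r F_0//; exists r.
  by rewrite /th big_ord_recr /= addrA; apply: has_angle_step; [exact/IH/ltnW|exact: hn].
have thper k : th k (pi *+ 2) = th k 0.
  by apply: eq_bigr => j _; rewrite /st !Fper.
have cF' k : continuous (fun t => F (k%:R / n.+1%:R, t)) by apply: cont_comp => //; cont.
have cst k : (k <= n)%N -> {within `[0, pi *+ 2], continuous (st k)}.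
  move=> kn; apply/subspace_continuousP => t /=; rewrite in_itv /= => tT.
  suff h : {for t, continuous (st k)} by exact: cvg_within_filter.
  apply: (@continuous_comp _ _ _ _ atan); last exact: continuous_atan.
  apply: cvgM; first exact: continuous_crossp.
  apply: cvgV; first by rewrite gt_eqF// hn.
  exact: continuous_dotp.
have cth k : (k <= n.+1)%N -> {within `[0, pi *+ 2], continuous (fun t => t + th k t)}.
  elim: k => [_|k IH kn].
    apply: continuous_subspaceT; rewrite (_ : (fun t => _) = fun t => t); first exact: cont_id.
    by apply/funext => t; rewrite /th big_ord0 addr0.
  rewrite (_ : (fun t => _) = fun t => (t + th k t) + st k t); last first.
    by apply/funext => t; rewrite /th big_ord_recr /= addrA.
  by move=> t; apply: cvgD; [exact/IH/ltnW|exact: cst].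
(* At this time the angle has grown by pi; as [F (1, t) = F (1, 0)], one point would have two angles
   that differ by pi. *)
have [t] : exists2 t, t \in `[0, pi *+ 2] & t + th n.+1 t = pi + th n.+1 0.
  apply: IVT => //; first exact: cth.
  rewrite thper ge_min le_max mulr2n; have p0 := pi_ge0 R.
  by apply/andP; split; apply/orP; [left|right]; lra.
rewrite in_itv /= => tT e.
have h0 : 0 <= (0 : R) <= pi *+ 2 by rewrite lexx.
have a1 := ang n.+1 t (leqnn _) tT; have a2 := ang n.+1 0 (leqnn _) h0.
have n1 : n.+1%:R / n.+1%:R = 1 :> R by rewrite divff.
rewrite n1 F_1// in a1; rewrite n1 in a2.
have := has_angle_cos a1 a2; rewrite e add0r addrK cospi => /eqP.
by rewrite -subr_eq0 -opprD oppr_eq0 -(natrD _ 1 1) pnatr_eq0.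
Qed.

End Winding.

(** * Boundary points of discs *)

Section Disc.
Variable R : realType.
Local Notation disc := (closed_disc (0, 0) 1 : set (R * R)).

Lemma discE p : disc p <-> dotp p p <= 1.
Proof. by rewrite /closed_disc /dotp /= !subr0 !expr2 mulr1. Qed.

Lemma disc_compact : compact disc.
Proof.
have c1 : compact (`[-1, 1]%classic `*` `[-1, 1]%classic : set (R * R)).
  by apply: compact_setX; exact: segment_compact.
apply: subclosed_compact c1 _.
- by apply: closed_le_cont; cont.
- move=> -[a b] /discE; rewrite /dotp /= => h; split => /=; rewrite in_itv /=; nra.
Qed.

(** A continuous injection of a compact set into a Hausdorff space is an embedding: the image of [K]
    minus [U] is compact, hence closed, and misses [e z]. *)
Lemma compact_embedding_nbhs (X Y : topologicalType) (K : set X) (e : X -> Y) z N :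
  hausdorff_space Y -> compact K -> {within K, continuous e} ->
  {in K &, injective e} -> K z -> nbhs z N ->
  exists2 W, nbhs (e z) W & forall z', K z' -> W (e z') -> N z'.
Proof.
move=> Yh Kc ce ei Kz; rewrite nbhsE => -[U [Uo Uz] UN].
exists (~` (e @` (K `&` ~` U))); last first.
  move=> z' Kz' h; apply: UN; apply: contrapT => Uz'; apply: h.
  by exists z'.
apply: open_nbhs_nbhs; split.
  apply: closed_openC; apply: compact_closed => //.
  apply: continuous_compact; first by apply: continuous_subspaceW ce => ? [].
  by apply: compact_closedI => //; exact: open_closedC.
by move=> [z' [Kz' Uz']] /ei; rewrite !inE => /(_ Kz' Kz) zz; apply: Uz'; rewrite zz.
Qed.

Lemma disc_convex (p q : R * R) s : disc p -> disc q -> 0 <= s <= 1 ->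
  disc ((1 - s) * p.1 + s * q.1, (1 - s) * p.2 + s * q.2).
Proof.
move=> /discE hp /discE hq /andP[s0 s1]; apply/discE; rewrite /dotp /= in hp hq *.
have h1 := mulr_ge0 s0 (sqr_ge0 (p.1 - q.1)).
have h2 := mulr_ge0 s0 (sqr_ge0 (p.2 - q.2)).
have s1' : 0 <= 1 - s by lra.
have h1' := mulr_ge0 s1' h1; have h2' := mulr_ge0 s1' h2.
have hp' := ler_wpM2l s1' hp; have hq' := ler_wpM2l s0 hq.
lra.
Qed.

Lemma dotp_circle_lt1 (b z : R * R) : dotp b b = 1 -> disc z -> z <> b ->
  dotp b z < 1.
Proof.
move=> hb /discE hz zb.
have : 0 < dotp (z.1 - b.1, z.2 - b.2) (z.1 - b.1, z.2 - b.2).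
  apply: dotpp_gt0 => -[/eqP + /eqP]; rewrite !subr_eq0 => /eqP a /eqP c.
  by apply: zb; rewrite [LHS]surjective_pairing a c -surjective_pairing.
rewrite /dotp /= in hb hz *; lra.
Qed.

(** On the disc the linear form [dotp b] reaches its maximum 1 at [b] only, so [b] is not between
    two other points of the disc. *)
Lemma disc_extreme (b p q : R * R) s : circle (0, 0) 1 b -> disc p -> disc q ->
  p <> b -> q <> b -> 0 <= s <= 1 ->
  ((1 - s) * p.1 + s * q.1, (1 - s) * p.2 + s * q.2) <> b.
Proof.
move=> hb hp hq pb qb /andP[s0 s1] h.
have b1 : dotp b b = 1.
  by move: hb; rewrite /circle /= /dotp !subr0 -!expr2 expr1n.
have := dotp_circle_lt1 b1 hp pb; have := dotp_circle_lt1 b1 hq qb.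
have : dotp b b = (1 - s) * dotp b p + s * dotp b q.
  by rewrite -[X in dotp _ X]h /dotp /=; ring.
clear h; rewrite b1; move: (dotp b p) (dotp b q) => x y e y1 x1; clear -s0 s1 e y1 x1.
have [s'0|s'0] := eqVneq s 0; first by rewrite s'0 in e; lra.
have sp : 0 < s by rewrite lt_neqAle eq_sym s'0.
have h1 : s * y < s by rewrite -[ltRHS]mulr1 ltr_pM2l.
have h2 : (1 - s) * x <= (1 - s) by rewrite -[leRHS]mulr1 ler_wpM2l//; lra.
lra.
Qed.

Lemma clamp_itv (s : R) : 0 <= Num.max 0 (Num.min 1 s) <= 1.
Proof. by rewrite le_max lexx /= ge_max ler01 ge_min lexx. Qed.

Lemma clamp_id (s : R) : 0 <= s <= 1 -> Num.max 0 (Num.min 1 s) = s.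
Proof. by move=> /andP[s0 s1]; rewrite (min_idPr s1) (max_idPr s0). Qed.

(** A small circle around [p0] is carried into the disc by the inverse of [e], shrunk there along
    line segments to one of its points, and brought back to the plane by the inverse of [f]. As the
    segments miss [b], the circle would be contractible in the plane minus [p0]. *)
Lemma boundary_not_interior (X : topologicalType) (e f : R * R -> X)
    (V : set (R * R)) (b p0 : R * R) :
  hausdorff_space X -> {within disc, continuous e} -> {in disc &, injective e} ->
  circle (0, 0) 1 b -> open V -> V p0 -> open_embedding V f -> f p0 = e b ->
  ~ nbhs (f p0) (e @` disc).
Proof.
move=> Xh ce ei hb Vo Vp fe fpb nK.
have discb : disc b by rewrite /closed_disc /=; rewrite /circle /= in hb; rewrite hb.
have nbV p : V p -> nbhs (f p) (f @` V) by exact: embedding_nbhsT.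
have cf p W : V p -> nbhs (f p) W -> nbhs p (f @^-1` W).
  move=> Vp' Wp; have nV : nbhs p V by apply: open_nbhs_nbhs.
  have [cf _ _] := fe.
  by apply: filterS2 nV (within_nbhs cf Vp' Wp) => q Vq; exact.
have /nbhs_ballP[d /= d0 bd] : nbhs b [set z | disc z -> (f @` V) (e z)].
  by apply: (within_nbhs ce) => //; rewrite -fpb; exact: nbV.
(* As b is an extreme point of the disc, the convex set C stays convex without
   b: see the use of disc_extreme below. *)
pose C z := disc z /\ ball b d z.
have Cconv p q s : C p -> C q -> 0 <= s <= 1 ->
    C ((1 - s) * p.1 + s * q.1, (1 - s) * p.2 + s * q.2).
  move=> [dp [bp1 bp2]] [dq [bq1 bq2]] s01; split; first exact: disc_convex.
  have conv (u v w : R) : `|u - v| < d -> `|u - w| < d ->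
      `|u - ((1 - s) * v + s * w)| < d.
    move=> uv uw; have -> : u - ((1 - s) * v + s * w) = (1 - s) * (u - v) + s * (u - w) by ring.
    apply: (le_lt_trans (ler_normD _ _)); rewrite !normrM.
    case/andP: s01 => s0 s1; rewrite (ger0_norm s0) ger0_norm ?subr_ge0//.
    have [->|sn] := eqVneq s 0; first by rewrite subr0 mul1r mul0r addr0.
    have sp : 0 < s by rewrite lt_neqAle eq_sym sn.
    have h1 : s * `|u - w| < s * d by rewrite ltr_pM2l.
    have h2 : (1 - s) * `|u - v| <= (1 - s) * d by rewrite ler_wpM2l ?subr_ge0// ltW.
    lra.
  by split; rewrite /ball /=; apply: conv.
have /boolp.choice[g gP] : forall y, exists z, (e @` disc) y -> disc z /\ e z = y.
  move=> y.
  by have [[z dz ez]|n] := pselect ((e @` disc) y); [exists z|exists (0, 0)].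
have [fi fiP] : exists fi, forall p, V p -> fi (f p) = p.
  have /boolp.choice[fi fiP] : forall y, exists z, (f @` V) y -> V z /\ f z = y.
    move=> y.
    by have [[z dz ez]|n] := pselect ((f @` V) y); [exists z|exists (0, 0)].
  exists fi => p Vp'; have [Vf ff] := fiP (f p) (imageP _ Vp').
  by case: fe => _ fin _; apply: (fin (fi (f p)) p); rewrite ?inE.
(* [W] forces preimages in the disc to lie within [d] of [b], hence in [C]; the circle is taken
   small enough to be mapped into [W]. *)
have [W Wb WN] := compact_embedding_nbhs Xh disc_compact ce ei discb (nbhsx_ballx b _ d0).
have Wn : nbhs (f p0) (e @` disc `&` W) by apply: filterI => //; rewrite fpb.
have /nbhs_ballP[r2 /= r20 br] : nbhs p0 (V `&` f @^-1` (e @` disc `&` W)).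
  by apply: filterI; [exact: open_nbhs_nbhs|exact: cf].
have [r r0 rr2] : exists2 r, 0 < r & r < r2 by exists (r2 / 2); lra.
pose ci (t : R) := (p0.1 + r * cos t, p0.2 + r * sin t).
have ciB t : ball p0 r2 (ci t).
  have rr u : `|u| <= 1 -> `|r * u| < r2.
    by move=> u1; rewrite normrM (gtr0_norm r0); nra.
  by split; rewrite /ball /= opprD addrA subrr add0r normrN; apply: rr;
    rewrite ler_norml ?cos_le1 ?cos_geN1 ?sin_le1 ?sin_geN1.
have aK (u v : R) : u + v - u = v by rewrite addrAC subrr add0r.
have ciV t : V (ci t) by case: (br _ (ciB t)).
pose ga t := g (f (ci t)).
have gaP t : disc (ga t) /\ e (ga t) = f (ci t).
  by apply: gP; case: (br _ (ciB t)) => _ [].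
have gaC t : C (ga t).
  have [dg eg] := gaP t; split => //; apply: WN => //; rewrite eg.
  by case: (br _ (ciB t)) => _ [].
have cci : continuous ci by rewrite /ci; cont.
have cga : continuous ga.
  move=> t N Nt; have [dg eg] := gaP t.
  have [W' W't W'N] := compact_embedding_nbhs Xh disc_compact ce ei dg Nt.
  rewrite eg in W't.
  have nt : nbhs t [set t' | W' (f (ci t'))] := cci t _ (cf _ _ (ciV t) W't).
  change (nbhs t [set t' | N (ga t')]); apply: filterS nt => t' /= h.
  by have [dg' eg'] := gaP t'; apply: W'N => //; rewrite eg'.
have gab t : ga t <> b.
  move=> h; have [_] := gaP t; rewrite h -fpb => /esym fc.
  have : ci t = p0 by case: fe => _ fin _; have := fin (ci t) p0; rewrite !inE; apply.
  move=> /(congr1 (fun q => (q.1 - p0.1) ^+ 2 + (q.2 - p0.2) ^+ 2)).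
  rewrite /= !aK !subrr !exprMn -mulrDr cos2Dsin2.
  by rewrite mulr1 => h'; have := exprn_gt0 2 r0; rewrite h' expr0n /= addr0 ltxx.
(* Clamping the homotopy parameter to [0, 1] makes [F] continuous on the whole plane, as
   [circle_not_nullhomotopic] requires. *)
pose cl (s : R) := Num.max 0 (Num.min 1 s).
pose ze (p : R * R) := ((1 - cl p.1) * (ga p.2).1 + cl p.1 * (ga 0).1,
                        (1 - cl p.1) * (ga p.2).2 + cl p.1 * (ga 0).2).
have cze : continuous ze.
  have cg2 : continuous (fun p : R * R => ga p.2) by apply: cont_comp => //; cont.
  by rewrite /ze /cl; cont.
have zeC p : C (ze p) by apply: Cconv => //; exact: clamp_itv.
have zeb p : ze p <> b.
  by apply: disc_extreme => //; rewrite ?clamp_itv//; case: (gaP p.2); case: (gaP 0).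
have zeV p : (f @` V) (e (ze p)) by case: (zeC p) => dz bz; exact: bd.
pose fz p := fi (e (ze p)).
have fzP p : V (fz p) /\ f (fz p) = e (ze p).
  by have [q Vq fq] := zeV p; rewrite /fz -fq fiP.
have cfz : continuous fz.
  move=> p N Np; have [Vz fq] := fzP p.
  have [W' W't W'N] := embedding_nbhs_inj fe Vz Np.
  rewrite fq in W't; have [dz _] := zeC p.
  have np : nbhs p [set p' | disc (ze p') -> W' (e (ze p'))] :=
    cze p _ (within_nbhs ce dz W't).
  change (nbhs p [set p' | N (fz p')]); apply: filterS np => p' /= h.
  have [Vz' fq'] := fzP p'; apply: W'N => //; rewrite fq'; apply: h.
  by case: (zeC p').
have cl0 : cl 0 = 0 by rewrite /cl clamp_id// lexx ler01.
have cl1 : cl 1 = 1 by rewrite /cl clamp_id// lexx ler01.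
pose F p := ((fz p).1 - p0.1, (fz p).2 - p0.2).
apply: (@circle_not_nullhomotopic _ F r) => //.
- by rewrite /F; cont.
- move=> p [/eqP + /eqP]; rewrite !subr_eq0 => /eqP h1 /eqP h2.
  have h : fz p = p0 by rewrite [LHS]surjective_pairing h1 h2 -surjective_pairing.
  have [_] := fzP p; rewrite h fpb => /esym/ei; rewrite !inE => /(_ _ discb) zb.
  by apply: (zeb p); apply: zb; case: (zeC p).
- move=> t _; have : fz (0, t) = ci t.
    rewrite /fz /ze /= cl0 subr0 !mul1r !mul0r !addr0 -surjective_pairing.
    by have [_ ->] := gaP t; rewrite fiP.
  by rewrite /F => -> /=; rewrite !aK.
- by move=> t _; rewrite /F /fz /ze /= cl1 subrr !mul0r !add0r.
- move=> s; have : ga (pi *+ 2) = ga 0.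
    by rewrite /ga /ci -[pi *+ 2]add0r cosD2pi sinD2pi.
  by rewrite /F /fz /ze /= => ->.
Qed.

End Disc.

(** * Homeomorphisms supported in a chart *)

Section Homeomorphism.
Variables (X : topologicalType).

Definition homeomorphism (h : X -> X) :=
  continuous h /\ exists g, [/\ continuous g, cancel h g & cancel g h].

Lemma homeomorphism_id : homeomorphism (fun x => x).
Proof. by split; [exact: cont_id|exists id; split => //; exact: cont_id]. Qed.

Lemma homeomorphism_comp h h' : homeomorphism h -> homeomorphism h' ->
  homeomorphism (fun x => h (h' x)).
Proof.
move=> [ch [g [cg hg gh]]] [ch' [g' [cg' hg' gh']]]; split.
  exact: cont_comp ch ch'.
exists (fun x => g' (g x)); split; first exact: cont_comp cg' cg.
- by move=> x; rewrite hg hg'.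
- by move=> x; rewrite gh' gh.
Qed.

Lemma homeomorphism_inj h : homeomorphism h -> injective h.
Proof. by move=> [_ [g [_ hg _]]]; exact: can_inj hg. Qed.

Lemma homeomorphism_open h (U : set X) : homeomorphism h -> open U -> open (h @` U).
Proof.
move=> [_ [g [cg hg gh]]] Uo; have -> : h @` U = g @^-1` U.
  apply/seteqP; split => [_ [x Ux <-]|x Ux]; first by rewrite /= hg.
  by exists (g x).
by move/continuousP : cg; exact.
Qed.

Lemma bounds_disc_homeomorphism (R : realType) h (L : set X) : homeomorphism h ->
  bounds_disc R L -> bounds_disc R (h @` L).
Proof.
move=> hh [e [ce ei eL eo]]; exists (fun p => h (e p)); split.
- apply: within_nbhsP => x W Dx hW; case: hh => ch _.
  exact: (@within_nbhs _ _ _ _ _ (h @^-1` W) ce Dx (ch _ _ hW)).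
- by move=> p q pD qD /(homeomorphism_inj hh); exact: ei.
- by rewrite -eL; apply/seteqP; split => [_ [x Lx <-]|_ [_ [x Lx <-] <-]];
    [exists (e x)|exists x].
- have -> : [set h (e p) | p in open_disc (0, 0) 1] = h @` (e @` open_disc (0, 0) 1).
    by apply/seteqP; split => [_ [x Lx <-]|_ [_ [x Lx <-] <-]]; [exists (e x)|exists x].
  exact: homeomorphism_open.
Qed.

(** Extension by the identity. The image of [K] under [f] is compact, hence closed, so near a point
    outside the chart nothing moves. *)
Lemma chart_map_continuous (Y : topologicalType) (V K : set Y) (f : Y -> X)
    (T : Y -> Y) (h : X -> X) :
  hausdorff_space X -> open V -> open_embedding V f -> compact K -> K `<=` V ->
  continuous T -> (forall p, V p -> V (T p)) -> (forall p, ~ K p -> T p = p) ->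
  (forall p, V p -> h (f p) = f (T p)) -> (forall x, ~ (f @` V) x -> h x = x) ->
  continuous h.
Proof.
move=> Xh Vo fe Kc KV cT TV TK hf hx x W; have [cf fi fo] := fe.
have nV p : V p -> nbhs p V by move=> Vp; apply: open_nbhs_nbhs.
change (nbhs (h x) W -> nbhs x [set y | W (h y)]).
have [[p Vp <-]|nfx] := pselect ((f @` V) x).
  rewrite hf// => nW.
  have N1 : nbhs p (T @^-1` [set q | V q -> W (f q)]).
    by apply: cT; exact: (within_nbhs cf (TV _ Vp) nW).
  apply: filterS (embedding_nbhs fe Vp N1) => _ [q [Vq /= h1] <-] /=.
  by rewrite hf//; exact/h1/TV.
rewrite hx// => nW.
have : nbhs x (~` (f @` K)).
  apply: open_nbhs_nbhs; split; last by move=> [p Kp px]; apply: nfx; exists p; auto.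
  apply: closed_openC; apply: compact_closed => //.
  by apply: continuous_compact => //; apply: continuous_subspaceW cf.
apply: filterS2 nW => y Wy nKy /=.
have [[p Vp yp]|nfy] := pselect ((f @` V) y); last by rewrite hx.
rewrite -yp hf//; have [Kp|nKp] := pselect (K p); first by case: nKy; exists p.
by rewrite TK// yp.
Qed.

Lemma chart_homeomorphism (Y : topologicalType) (V K : set Y) (f : Y -> X) (T T' : Y -> Y) :
  hausdorff_space X -> open V -> open_embedding V f -> compact K -> K `<=` V ->
  continuous T -> continuous T' -> cancel T T' -> cancel T' T ->
  (forall p, ~ K p -> T p = p) ->
  exists h, [/\ homeomorphism h, forall p, V p -> V (T p) /\ h (f p) = f (T p) &
    forall x, ~ (f @` V) x -> h x = x].
Proof.
move=> Xh Vo fe Kc KV cT cT' TT' T'T TK.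
have T'K p : ~ K p -> T' p = p by move=> /TK {1}<-; rewrite TT'.
(* A bijection that fixes every point outside [K] preserves [V]: a value outside [K] is its own
   preimage. *)
have TV p : V p -> V (T p).
  move=> Vp; have [/KV//|nK] := pselect (K (T p)).
  by have := T'K _ nK; rewrite TT' => <-.
have T'V p : V p -> V (T' p).
  move=> Vp; have [/KV//|nK] := pselect (K (T' p)).
  by have := TK _ nK; rewrite T'T => <-.
have ext S : (forall p, V p -> V (S p)) ->
    exists h : X -> X, (forall p, V p -> h (f p) = f (S p)) /\
      forall x, ~ (f @` V) x -> h x = x.
  move=> SV; have /boolp.choice[h hP] : forall x, exists y,
      (forall p, V p -> f p = x -> y = f (S p)) /\ (~ (f @` V) x -> y = x).
    move=> x; have [[p Vp px]|nx] := pselect ((f @` V) x).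
      exists (f (S p)); split => [q Vq qx|[]]; last by exists p.
      have [_ fi _] := fe; have := fi p q; rewrite !inE => /(_ Vp Vq) -> //.
      by rewrite qx.
    by exists x; split => // p Vp px; case: nx; exists p.
  exists h; split => [p Vp|x nx]; last by case: (hP x) => _; exact.
  by case: (hP (f p)) => h1 _; exact: h1.
have [h [hf hx]] := ext _ TV; have [g [gf gx]] := ext _ T'V.
exists h; split => //; last by move=> p Vp; split; auto.
split; first exact: (chart_map_continuous Xh Vo fe Kc KV cT).
exists g; split; first exact: (chart_map_continuous Xh Vo fe Kc KV cT').
- move=> x; have [[p Vp <-]|nx] := pselect ((f @` V) x); last by rewrite hx// gx.
  by rewrite hf// gf ?TT'//; auto.
- move=> x; have [[p Vp <-]|nx] := pselect ((f @` V) x); last by rewrite gx// hx.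
  by rewrite gf// hf ?T'T//; auto.
Qed.

End Homeomorphism.

(** * Tent maps of the plane *)

Section Tent.
Variable R : realType.
Implicit Types (a u k : R).

(* For |k| < 1, a homeomorphism of the plane which is the identity where
   |u| >= A t and moves (t, 0) to (t, k * A t) where A t >= 0. *)
Definition tent k (A : R -> R) (p : R * R) :=
  (p.1, p.2 + k * Num.max 0 (A p.1 - `|p.2|)).

(** Solving for the height m of the tent from the image ordinate u: m = (A t - u) / (1 - k) for a
    point coming from above the axis, m = (A t + u) / (1 + k) for one coming from below. The smaller
    value is the right one, and the maximum with 0 covers the points that do not move. *)
Definition untent k (A : R -> R) (p : R * R) :=
  (p.1, p.2 - k * Num.max 0
    (Num.min ((A p.1 - p.2) / (1 - k)) ((A p.1 + p.2) / (1 + k)))).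

Lemma tentK k A : `|k| < 1 -> cancel (tent k A) (untent k A).
Proof.
rewrite ltr_norml => /andP[k1 k2] [t u]; rewrite /tent /untent /=; congr pair.
move: (A t) => a {A t}.
have p1 : 0 < 1 - k by lra.
have p2 : 0 < 1 + k by lra.
set m := Num.max 0 (a - `|u|).
suff -> : Num.max 0 (Num.min ((a - (u + k * m)) / (1 - k)) ((a + (u + k * m)) / (1 + k))) = m.
  by rewrite addrK.
rewrite /m; have [au|au] := leP (a - `|u|) 0.
  rewrite mulr0 addr0; apply/max_idPl; rewrite ge_min.
  by case: (ger0P u) au => u0 au; apply/orP; [left|right];
    rewrite mulr_le0_ge0// ?invr_ge0; lra.
case: (ger0P u) au => u0 au.
  have -> : (a - (u + k * (a - u))) / (1 - k) = a - u.
    by rewrite (_ : a - _ = (a - u) * (1 - k)) ?mulfK ?gt_eqF//; ring.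
  rewrite min_l ?max_r//; first exact: ltW.
  by rewrite ler_pdivlMr//; lra.
have -> : (a + (u + k * (a - - u))) / (1 + k) = a - - u.
  by rewrite (_ : a + _ = (a - - u) * (1 + k)) ?mulfK ?gt_eqF//; ring.
rewrite min_r ?max_r//; first exact: ltW.
by rewrite ler_pdivlMr//; lra.
Qed.

Lemma untentK k A : `|k| < 1 -> cancel (untent k A) (tent k A).
Proof.
rewrite ltr_norml => /andP[k1 k2] [t u]; rewrite /tent /untent /=; congr pair.
move: (A t) => a {A t}.
have p1 : 0 < 1 - k by lra.
have p2 : 0 < 1 + k by lra.
set m := Num.max 0 (Num.min _ _).
suff -> : Num.max 0 (a - `|u - k * m|) = m by rewrite subrK.
have [m0|m0] := leP (Num.min ((a - u) / (1 - k)) ((a + u) / (1 + k))) 0.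
  rewrite /m (max_idPl m0) mulr0 subr0; apply/max_idPl.
  move: m0; rewrite ge_min !pmulr_lle0 ?invr_gt0//.
  by have := ler_norm u; have := ler_norm (- u); rewrite normrN => h1 h2 /orP[]; lra.
have em : m = Num.min ((a - u) / (1 - k)) ((a + u) / (1 + k)) by exact/max_idPr/ltW.
have e1 : m * (1 - k) <= a - u by rewrite -ler_pdivlMr// em ge_min lexx.
have e2 : m * (1 + k) <= a + u by rewrite -ler_pdivlMr// em ge_min lexx orbT.
rewrite -em in m0.
suff -> : `|u - k * m| = a - m by rewrite opprB addrCA subrr addr0 (max_idPr (ltW m0)).
have [e|e] : m * (1 - k) = a - u \/ m * (1 + k) = a + u.
- move: em; rewrite minElt; case: ifP => _ ->; [left|right];
    by rewrite divfK// gt_eqF.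
- by rewrite ger0_norm; lra.
- by rewrite ler0_norm; lra.
Qed.

Lemma tent_continuous k A : continuous A -> continuous (tent k A).
Proof.
move=> cA; have cA1 : continuous (fun p : R * R => A p.1) by apply: cont_comp => //; cont.
by rewrite /tent; cont.
Qed.

Lemma untent_continuous k A : continuous A -> continuous (untent k A).
Proof.
move=> cA; have cA1 : continuous (fun p : R * R => A p.1) by apply: cont_comp => //; cont.
by rewrite /untent; cont.
Qed.

Lemma chart_tent (X : topologicalType) (V : set (R * R)) (f : R * R -> X) k A :
  hausdorff_space X -> open V -> open_embedding V f -> `|k| < 1 -> continuous A ->
  compact [set p : R * R | `|p.2| <= A p.1] -> [set p : R * R | `|p.2| <= A p.1] `<=` V ->
  exists h, [/\ homeomorphism h, forall p, V p -> V (tent k A p) /\ h (f p) = f (tent k A p) &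
    forall x, ~ (f @` V) x -> h x = x].
Proof.
move=> Xh Vo fe k1 cA Kc KV.
apply: (chart_homeomorphism (T' := untent k A) Xh Vo fe Kc KV).
- exact: tent_continuous.
- exact: untent_continuous.
- exact: tentK.
- exact: untentK.
- move=> [t u] /= /negP; rewrite -ltNge => h.
  by rewrite /tent /= (max_idPl _) ?mulr0 ?addr0// subr_le0 ltW.
Qed.

End Tent.

(** * Passages and edges *)

Definition other l := match l with Over => Under | Under => Over end.

Lemma neq_other l m : l <> m -> m = other l. Proof. by case: l; case: m. Qed.

Definition strand_sign {R : realType} l : R := match l with Over => 1 | Under => -1 end.

Section Diagram.
Variables (R : realType) (Sigma : oriented_surface R) (D : link_diagram Sigma).
Implicit Types (i j : 'I_(ncomp D)) (s t u a b : R) (x y z : crossing D) (l m : strand).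

Local Notation off := (at_offset (period D) (passage D)).
Local Notation per := (period D).
Local Notation tau y l := (passage D y l).2.
Local Notation comp y l := (passage D y l).1.

Lemma per_gt0 i : 0 < per i. Proof. exact: period_gt0. Qed.

Lemma off_add i s y l a c : off i s y l a -> off i (s + c) y l (a + c).
Proof. by move=> [ei [k ->]]; split => //; exists k; ring. Qed.

Lemma off_sub i s y l a : off i s y l a -> off i (s - a) y l 0.
Proof. by move=> /(@off_add _ _ _ _ _ (- a)); rewrite subrr. Qed.

Lemma off_shift i s y l a (k : int) : off i s y l a -> off i (s + k%:~R * per i) y l a.
Proof. by move=> [ei [k' ->]]; split => //; exists (k' + k); rewrite intrD; ring. Qed.

Lemma off_passage y l a : off (comp y l) (tau y l + a) y l a.
Proof. by split => //; exists 0; rewrite mul0r addr0. Qed.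

Lemma off_inj i s y l a z m b : `|a| < 1 -> `|b| < 1 ->
  off i s y l a -> off i s z m b -> [/\ y = z, l = m & a = b].
Proof. exact: passages_disjoint. Qed.

Lemma off0_inj i s y l z m : off i s y l 0 -> off i s z m 0 -> y = z /\ l = m.
Proof.
move=> h1 h2; have n0 : `|0 : R| < 1 by rewrite normr0.
by have [-> ->] := off_inj n0 n0 h1 h2.
Qed.

Lemma ribbon_shift i s u (k : int) : `|u| < 1 ->
  ribbon D i (s + k%:~R * per i, u) = ribbon D i (s, u).
Proof.
move=> u1; have h (n : nat) s' : ribbon D i (s' + n%:R * per i, u) = ribbon D i (s', u).
  elim: n => [|n IH]; first by rewrite mul0r addr0.
  by rewrite -addn1 natrD mulrDl mul1r addrA ribbon_periodic.
case: k => n; first exact: h.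
by rewrite NegzE -[LHS](h n.+1) mulrNz mulNr subrK.
Qed.

(** For [l = Over] this is convertible to [crossing_chart y]; having it for both strands allows
    symmetric statements. *)
Definition square y l (p : R * R) := ribbon D (comp y l) (tau y l + p.1, p.2).

Lemma off_square i s y l a u : `|u| < 1 -> off i s y l a ->
  ribbon D i (s, u) = square y l (a, u).
Proof. by move=> u1 [-> [k ->]]; rewrite ribbon_shift. Qed.

(** The factor [strand_sign l] gives one formula for the change of coordinates from either strand to
    the other: the inverse of a quarter turn is the opposite quarter turn. *)
Definition turn y l : R := strand_sign l * (-1) ^+ crossing_sign y.

Lemma turn_sqr y l : turn y l * turn y l = 1.
Proof. by rewrite /turn; case: l => /=; case: crossing_sign => /=; ring. Qed.

Lemma norm_turn y l : `|turn y l| = 1.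
Proof. by rewrite /turn normrM normr_sign mulr1; case: l; rewrite /= ?normrN normr1. Qed.

Lemma square_other y l p : `|p.1| < 1 -> `|p.2| < 1 ->
  square y l p = square y (other l) (turn y l * p.2, - (turn y l * p.1)).
Proof.
rewrite /square; case: l p => -[a b] /= a1 b1.
  by rewrite ribbon_crossing// /turn /= mul1r.
have ts : turn y Under = - (-1) ^+ crossing_sign y by rewrite /turn mulN1r.
have s1 : `|turn y Under| = 1 := norm_turn y Under.
have h1 : `|turn y Under * b| < 1 by rewrite normrM s1 mul1r.
have h2 : `|- (turn y Under * a)| < 1 by rewrite normrN normrM s1 mul1r.
rewrite [RHS](ribbon_crossing y h1 h2) ts.
by congr (ribbon D _ (_ + _, _)); case: crossing_sign => /=; ring.
Qed.

Lemma square_inj y l p q : `|p.1| < 1 -> `|p.2| < 1 -> `|q.1| < 1 -> `|q.2| < 1 ->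
  square y l p = square y l q -> p = q.
Proof.
case: p q => [p1 p2] [q1 q2] /= hp1 hp2 hq1 hq2 /(ribbon_injective hp2 hq2) /=.
case=> [[_ -> [k e]]|[z [l1 [l2 [nl [a a1 oa] [b b1 ob]]]]]].
  have h := off_shift k (off_passage y l p1); rewrite -e in h.
  by have [_ _ ->] := off_inj hp1 hq1 h (off_passage y l q1).
have [_ e1 _] := off_inj hp1 a1 (off_passage y l p1) oa.
have [_ e2 _] := off_inj hq1 b1 (off_passage y l q1) ob.
by case: nl; rewrite -e1.
Qed.

(** [ribbon_injective] only places both points in the square of one crossing; comparing their
    coordinates there, by [square_other] and [square_inj], determines the offsets. *)
Lemma ribbon_coincide i j s t u v : `|u| < 1 -> `|v| < 1 ->
  ribbon D i (s, u) = ribbon D j (t, v) ->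
  [/\ i = j, u = v & exists k : int, t = s + k%:~R * per i] \/
  exists y l a, [/\ `|a| < 1, off i s y l a, off j t y (other l) (turn y l * u) &
    v = - (turn y l * a)].
Proof.
move=> u1 v1 e; case: (ribbon_injective u1 v1 e) => [|[y [l [m [nl [a a1 oa] [b b1 ob]]]]]].
  by left.
right; exists y, l, a; rewrite (neq_other nl) in ob.
have := e; rewrite (off_square u1 oa) (off_square v1 ob) square_other//=.
have ne c : `|c| < 1 -> `|turn y l * c| < 1 by rewrite normrM norm_turn mul1r.
move=> /square_inj /=; rewrite normrN => /(_ (ne _ u1) (ne _ a1) b1 v1) [-> <-].
by split.
Qed.

(** Off the axis of a band, the diagram shows up only as the transverse strand of a crossing, where
    the offset is 0. *)
Lemma strip_not_diagram i s u : `|u| < 1 -> u != 0 ->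
  diagram_curve D (ribbon D i (s, u)) -> exists y l, off i s y l 0.
Proof.
move=> u1 u0 [j [t]]; have n0 : `|0 : R| < 1 by rewrite normr0.
case/(ribbon_coincide u1 n0) => [[_ e _]|[y [l [a [a1 oa _ /esym/eqP]]]]].
  by rewrite e eqxx in u0.
rewrite oppr_eq0 mulf_eq0 => /orP[/eqP t0|/eqP a0].
  by have := norm_turn y l; rewrite t0 normr0 => /esym/eqP; rewrite oner_eq0.
by exists y, l; rewrite -a0.
Qed.

Lemma square_not_diagram y l p : `|p.1| < 1 -> `|p.2| < 1 -> p.1 != 0 -> p.2 != 0 ->
  ~ diagram_curve D (square y l p).
Proof.
move=> p1 p2 n1 n2 /(strip_not_diagram p2 n2) [z [m o]].
have n0 : `|0 : R| < 1 by rewrite normr0.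
have [_ _ e] := off_inj p1 n0 (off_passage y l p.1) o.
by rewrite e eqxx in n1.
Qed.

Lemma square_eq y l p z m q :
  `|p.1| < 1 -> `|p.2| < 1 -> `|q.1| < 1 -> `|q.2| < 1 ->
  square y l p = square z m q -> y = z /\
   ((l = m /\ p = q) \/ (m = other l /\ q = (turn y l * p.2, - (turn y l * p.1)))).
Proof.
case: p q => [p1 p2] [q1 q2] /= hp1 hp2 hq1 hq2 e.
have [[ei e2 [k ek]]|[x [n [a [a1 oa ob ->]]]]] := ribbon_coincide hp2 hq2 e.
  have h := off_shift k (off_passage y l p1); rewrite -ek ei in h.
  have [-> -> ->] := off_inj hp1 hq1 h (off_passage z m q1).
  by rewrite e2; split => //; left.
have [-> -> ->] := off_inj hp1 a1 (off_passage y l p1) oa.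
have t1 : `|turn x n * p2| < 1 by rewrite normrM norm_turn mul1r.
have [-> -> ->] := off_inj hq1 t1 (off_passage z m q1) ob.
by split => //; right.
Qed.

(** The identity on products tells in which pair of opposite quadrants of the crossing the point
    [(a, u)] of strand [l] lies; the sign comes from the quarter turn, which exchanges both pairs.
    This locates the smoothing arcs with respect to an edge. *)
Lemma ribbon_in_square i s u y p : `|u| < 1 -> `|p.1| < 1 -> `|p.2| < 1 ->
  ribbon D i (s, u) = square y Over p ->
  exists l a, [/\ `|a| < 1, off i s y l a, strand_sign l * (a * u) = p.1 * p.2 &
    (l = Over /\ p = (a, u)) \/ (l = Under /\ `|p.1| = `|u| /\ `|p.2| = `|a|)].
Proof.
case: p => [p1 p2] /= u1 hp1 hp2 e.
have [[ei <- [k ek]]|[x [l [a [a1 oa ob ->]]]]] := ribbon_coincide u1 hp2 e.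
  exists Over, p1; split => //; last by left.
    have := off_shift (- k) (off_passage y Over p1); rewrite ek -ei.
    by rewrite mulrNz mulNr addrK.
  by rewrite /= mul1r.
have t1 : `|turn x l * u| < 1 by rewrite normrM norm_turn mul1r.
have [yx lo ep] := off_inj hp1 t1 (off_passage y Over p1) ob.
have lU : l = Under by case: (l) lo.
subst l x; exists Under, a; split => //.
  rewrite /= ep; have := turn_sqr y Under; move: (turn y Under) => c cc.
  by transitivity (- (c * c) * (a * u)); [rewrite cc; ring|ring].
right; split => //; rewrite /= ep; split; first by rewrite normrM norm_turn mul1r.
by rewrite normrN normrM norm_turn mul1r.
Qed.

Lemma prev_passage y l t : exists s z m, [/\ off (comp y l) s z m 0, s <= t &
  forall r x n, s < r <= t -> ~ off (comp y l) r x n 0].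
Proof.
set i := comp y l; have P0 := per_gt0 i.
pose st (b : bool) := if b then Over else Under.
have stK (n : strand) : exists b : bool, st b = n by case: n; [exists true|exists false].
pose Q (q : crossing D * bool) := i == comp q.1 (st q.2).
pose r (q : crossing D * bool) :=
  tau q.1 (st q.2) + (Num.floor ((t - tau q.1 (st q.2)) / per i))%:~R * per i.
have [b0 eb0] := stK l.
have Q0 : Q (y, b0) by rewrite /Q /= eb0.
have [[z b] /eqP /= Qz rmax] := arg_maxP r Q0.
exists (r (z, b)), z, (st b); split.
- by split => //; exists (Num.floor ((t - tau z (st b)) / per i)); rewrite addr0.
- rewrite /r /= addrC -lerBrDr -ler_pdivlMr//; exact: floor_le.
- move=> r' x n /andP[r1 r2] [ei [k]]; rewrite addr0 => er.
  have [b' eb'] := stK n.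
  have : r' <= r (x, b').
    rewrite er /r /= eb' lerD2l ler_pM2r// ler_int floor_ge_int ler_pdivlMr//.
    by rewrite lerBrDr addrC -er.
  have : r (x, b') <= r (z, b) by apply: rmax; rewrite /Q /= eb' -ei.
  by move=> h1 h2; have := lt_le_trans r1 (le_trans h2 h1); rewrite ltxx.
Qed.

Lemma next_passage y l t : exists s z m, [/\ off (comp y l) s z m 0, t < s &
  forall r x n, t < r < s -> ~ off (comp y l) r x n 0].
Proof.
set i := comp y l; have P0 := per_gt0 i.
pose st (b : bool) := if b then Over else Under.
have stK (n : strand) : exists b : bool, st b = n by case: n; [exists true|exists false].
pose Q (q : crossing D * bool) := i == comp q.1 (st q.2).
(* The added 1 makes the occurrence strictly later than [t], so that an edge does not end at the
   time it starts. *)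
pose r (q : crossing D * bool) :=
  tau q.1 (st q.2) + (Num.floor ((t - tau q.1 (st q.2)) / per i) + 1)%:~R * per i.
have [b0 eb0] := stK l.
have Q0 : Q (y, b0) by rewrite /Q /= eb0.
have [[z b] /eqP /= Qz rmin] := arg_minP r Q0.
exists (r (z, b)), z, (st b); split.
- by split => //; exists (Num.floor ((t - tau z (st b)) / per i) + 1); rewrite addr0.
- rewrite /r /= addrC -ltrBlDr -ltr_pdivrMr//.
  by case/andP: (floor_itv ((t - tau z (st b)) / per i)).
- move=> r' x n /andP[r1 r2] [ei [k]]; rewrite addr0 => er.
  have [b' eb'] := stK n.
  have : r (x, b') <= r'.
    rewrite er /r /= eb' lerD2l ler_pM2r// ler_int lezD1 -(ltr_int R).
    apply: (le_lt_trans (floor_le _)).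
    by rewrite ltr_pdivrMr// ltrBlDr addrC -er.
  have : r (z, b) <= r (x, b') by apply: rmin; rewrite /Q /= eb' -ei.
  by move=> h1 h2; have := lt_le_trans r2 (le_trans h1 h2); rewrite ltxx.
Qed.

(** Times are taken on the line covering the component: an edge that goes once around, from a
    passage to itself, is the case [s' = s + period D i]. *)
Definition edge i s y l s' y' l' :=
  [/\ s < s', off i s y l 0, off i s' y' l' 0 &
      forall r x n, s < r < s' -> ~ off i r x n 0].

Lemma edge_from y l : exists s' y' l', edge (comp y l) (tau y l) y l s' y' l'.
Proof.
have [s' [y' [l' [h1 h2 h3]]]] := next_passage y l (tau y l).
by exists s', y', l'; split => //; rewrite -[tau y l]addr0; exact: off_passage.
Qed.

Lemma edge_at z n t : exists s y l s' y' l',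
  edge (comp z n) s y l s' y' l' /\ s <= t < s'.
Proof.
have [s [y [l [h1 h2 h3]]]] := prev_passage z n t.
have [s' [y' [l' [h4 h5 h6]]]] := next_passage z n t.
exists s, y, l, s', y', l'; split; last by rewrite h2.
split => //; first exact: le_lt_trans h5.
move=> r x m /andP[r1 r2]; have [rt|tr] := leP r t.
  by apply: h3; rewrite r1.
by apply: h6; rewrite tr.
Qed.

Lemma edge_shift i s y l s' y' l' (k : int) : edge i s y l s' y' l' ->
  edge i (s + k%:~R * per i) y l (s' + k%:~R * per i) y' l'.
Proof.
move=> [h1 h2 h3 h4]; split; [by rewrite ltrD2r|exact: off_shift..|].
move=> r x n /andP[r1 r2] /(off_shift (- k)).
rewrite mulrNz mulNr; apply: h4.
by apply/andP; split; lra.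
Qed.

(** Lower bound: otherwise the middle of the edge would have two opposite offsets smaller than 1,
    which [off_inj] makes equal. Upper bound: the initial passage recurs after one period. *)
Lemma edge_length i s y l s' y' l' : edge i s y l s' y' l' -> 2 <= s' - s <= per i.
Proof.
move=> [h1 h2 h3 h4]; apply/andP; split.
  rewrite leNgt; apply/negP => h.
  have a1 : `|(s' - s) / 2| < 1 by rewrite ger0_norm; lra.
  have a2 : `|- ((s' - s) / 2)| < 1 by rewrite normrN.
  have o1 := off_add ((s' - s) / 2) h2; have o2 := off_add (- ((s' - s) / 2)) h3.
  rewrite add0r in o1; rewrite add0r in o2; have e : s + (s' - s) / 2 = s' - (s' - s) / 2 by lra.
  by rewrite e in o1; have [_ _] := off_inj a1 a2 o1 o2; lra.
rewrite leNgt; apply/negP => h.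
apply: (h4 (s + per i) y l); last by have := off_shift 1 h2; rewrite mul1r.
by have P0 := per_gt0 i; apply/andP; split; lra.
Qed.

Lemma edge_unique i t s y l s' y' l' s1 y1 l1 s1' y1' l1' :
  edge i s y l s' y' l' -> edge i s1 y1 l1 s1' y1' l1' ->
  s < t < s' -> s1 < t < s1' -> s = s1 /\ s' = s1'.
Proof.
move=> [h1 h2 h3 h4] [g1 g2 g3 g4] /andP[t1 t2] /andP[t3 t4]; split.
  case: (ltgtP s s1) => // h; [case: (h4 _ _ _ _ g2)|case: (g4 _ _ _ _ h2)];
    by apply/andP; split; lra.
case: (ltgtP s' s1') => // h; [case: (g4 _ _ _ _ h3)|case: (h4 _ _ _ _ g3)];
  by apply/andP; split; lra.
Qed.

(** A passage is never inside the edge; were it beyond an end, this end would be nearer still, and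
    [off_inj] forbids two distinct offsets smaller than 1. *)
Lemma edge_offset i t s y l s' y' l' z m a : edge i s y l s' y' l' -> s < t < s' ->
  `|a| < 1 -> off i t z m a ->
  [/\ 0 < a, s = t - a, z = y & m = l] \/ [/\ a < 0, s' = t - a, z = y' & m = l'].
Proof.
move=> [h1 h2 h3 h4] /andP[t1 t2] a1 o; have o0 := off_sub o.
have n1 : -1 < a /\ a < 1 by apply/andP; rewrite -ltr_norml.
have [a0|a0|a0] := ltgtP 0 a.
- left; have e : s = t - a.
    have [h|h|//] := ltgtP s (t - a).
      by case: (h4 _ _ _ _ o0); apply/andP; split; lra.
    have b1 : `|t - s| < 1 by rewrite ger0_norm; lra.
    have o2 := off_add (t - s) h2; rewrite add0r addrC subrK in o2.
    by have [_ _ ?] := off_inj a1 b1 o o2; lra.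
  by rewrite -e in o0; have [-> ->] := off0_inj o0 h2.
- right; have e : s' = t - a.
    have [h|h|//] := ltgtP s' (t - a).
      have b1 : `|t - s'| < 1 by rewrite ler0_norm; lra.
      have o2 := off_add (t - s') h3; rewrite add0r addrC subrK in o2.
      by have [_ _ ?] := off_inj a1 b1 o o2; lra.
    by case: (h4 _ _ _ _ o0); apply/andP; split; lra.
  by rewrite -e in o0; have [-> ->] := off0_inj o0 h3.
- by rewrite -a0 in o; case: (h4 _ _ _ _ o); rewrite t1.
Qed.

Lemma alternating_edge i s y l s' y' l' : alternating D -> edge i s y l s' y' l' ->
  s' < s + per i -> l' = other l.
Proof.
move=> alt [h1 h2 h3 h4] h; apply: neq_other; apply: (alt i s s').
- by rewrite h1.
- by exists y.
- by exists y'.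
- by move=> r m /h4 n [x]; exact: n.
Qed.

(** Reducing any time modulo the period brings it into [s, s + period), where the only passage is
    the initial one. *)
Lemma odd_edge i s y l y' l' : edge i s y l (s + per i) y' l' ->
  [/\ y' = y, l' = l & forall r z m, off i r z m 0 ->
     z = y /\ m = l /\ exists k : int, r = s + k%:~R * per i].
Proof.
move=> he; have [h1 h2 h3 h4] := he.
have h5 : off i (s + per i) y l 0 by have := off_shift 1 h2; rewrite mul1r.
have [-> ->] := off0_inj h3 h5; split => // r z m o.
have P0 := per_gt0 i; pose k := Num.floor ((r - s) / per i).
have /andP[k1 k2] := floor_itv ((r - s) / per i); rewrite -/k in k1 k2.
rewrite ler_pdivlMr// in k1; rewrite ltr_pdivrMr// intrD mulrDl mul1r in k2.
have o2 := off_shift (- k) o; rewrite mulrNz mulNr in o2.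
have [e|ne] := eqVneq (r - s) (k%:~R * per i).
  have {}e : r = s + k%:~R * per i by rewrite -e addrC subrK.
  rewrite e addrK in o2; have [-> ->] := off0_inj o2 h2.
  by split => //; split => //; exists k.
case: (h4 _ _ _ _ o2); move: k1; rewrite le_eqVlt eq_sym (negbTE ne) /= => k1.
by apply/andP; split; lra.
Qed.

End Diagram.

(** * Connected components *)

Definition components (T : topologicalType) (A : set T) : set (set T) :=
  connected_component A @` A.

Section Components.
Variable T : topologicalType.
Implicit Types A B C Y : set T.

Lemma components_absorb A B C : components A C -> connected B -> B `<=` A ->
  B `&` C !=set0 -> B `<=` C.
Proof.
move=> [a Aa <-] Bc BA [b [Bb ab]].
by rewrite (same_connected_component ab); exact: connected_component_max.
Qed.

Lemma components_sub A C : components A C -> C `<=` A.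
Proof. by move=> [a Aa <-]; exact: connected_component_sub. Qed.

Lemma components_connected A C : components A C -> connected C.
Proof. by move=> [a Aa <-]; exact: component_connected. Qed.

Lemma components_nonempty A C : components A C -> C !=set0.
Proof. by move=> [a Aa <-]; exists a; exact: connected_component_refl. Qed.

Lemma components_eq A C C' : components A C -> components A C' ->
  C `&` C' !=set0 -> C = C'.
Proof.
move=> h h' CC; apply/seteqP; split.
  by apply: (components_absorb h') => //; [exact: components_connected h|exact: components_sub h].
apply: (components_absorb h); [exact: components_connected h'|exact: components_sub h'|].
by rewrite setIC.
Qed.

Lemma components_cover A a : A a -> exists2 C, components A C & C a.
Proof.
by move=> Aa; exists (connected_component A a); [exists a|exact: connected_component_refl].
Qed.

Variables (J : finType) (P : J -> set T).
Hypotheses (Pclosed : forall k, closed (P k)) (Pconn : forall k, connected (P k)).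

Lemma components_finite A : (forall k, P k `<=` A) ->
  A `<=` \bigcup_k P k -> finite_set (components A).
Proof.
move=> PA AP.
have /boolp.choice[g gP] : forall k, exists C, forall a, P k a -> C = connected_component A a.
  move=> k; have [[a Pa]|n] := pselect (P k !=set0); last by exists set0 => a Pa; case: n; exists a.
  exists (connected_component A a) => b Pb; apply: same_connected_component.
  by apply: (connected_component_max Pa (PA k) (@Pconn k)).
apply: (@sub_finite_set _ _ (range g)); last first.
  exact/finite_image/finite_finset.
by move=> C [a Aa <-]; have [k _ Pa] := AP a Aa; exists k => //; exact: gP.
Qed.

(** [C] is a union of pieces, while the remaining pieces and [Y'] form a closed set disjoint from
    [C]. So [C] is open and closed in [A'], hence a whole component. The hypothesis on the pieces
    and [Y'] prevents [Y'] from touching [C], which avoids [Y]. *)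
Lemma components_avoid A A' Y Y' C : A = \bigcup_k P k `|` Y -> A' = \bigcup_k P k `|` Y' ->
  closed Y -> closed Y' -> (\bigcup_k P k) `&` Y' `<=` Y -> components A C -> C `&` Y = set0 ->
  components A' C /\ C `&` Y' = set0.
Proof.
move=> eA eA' Yclosed Y'c Y'Y hC CY.
have CP : C `<=` \bigcup_k P k.
  move=> c Cc; have := components_sub hC Cc; rewrite eA => -[//|Yc].
  by have : (C `&` Y) c by []; rewrite CY.
have CY' : C `&` Y' = set0.
  apply/seteqP; split => // c [Cc Yc].
  by rewrite -CY; split => //; apply: Y'Y; split => //; exact: CP.
split => //; have [a Ca] := components_nonempty hC.
exists a; first by rewrite eA'; left; exact: CP.
have CA' : C `<=` A' by rewrite eA' => c /CP; left.
set C' := connected_component A' a.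
have CC' : C `<=` C' by apply: connected_component_max => //; exact: components_connected hC.
pose F := (\bigcup_(k in [set k | P k `&` C = set0]) P k) `|` Y'.
have Fc : closed F.
  by apply: closedU => //; apply: closed_bigcup => //; exact: finite_finset.
have CF c : C c -> ~ F c.
  move=> Cc [[k /= kC kc]|Yc]; first by have : (P k `&` C) c by []; rewrite kC.
  by have : (C `&` Y') c by []; rewrite CY'.
have A'CF : A' `<=` C `|` F.
  rewrite eA' => c [[k _ kc]|Yc]; last by right; right.
  have [e|/set0P ne] := eqVneq (P k `&` C) set0; first by right; left; exists k.
  left; apply: (components_absorb hC (@Pconn k)) => //.
  by rewrite eA => z kz; left; exists k.
have Pc : closed (\bigcup_k P k).
  by apply: closed_bigcup => //; exact: finite_finset.
have Cclosed : closed C.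
  by case: hC => c0 _ <-; apply: component_closed; rewrite eA; exact: closedU.
have C'A' : C' `<=` A' by exact: connected_component_sub.
apply/esym; apply: (@component_connected _ A' a); first by exists a.
- exists (~` F); first exact: closed_openC.
  apply/seteqP; split => [c Cc|c [C'c Fc']]; first by split; [exact: CC'|exact: CF].
  by have [//|/Fc'] := A'CF c (C'A' c C'c).
- exists C => //; apply/seteqP; split => [c Cc|c [_ //]].
  by split => //; exact: CC'.
Qed.

End Components.

(** * Counting the loops of two adjacent states *)

Section CardEqSubset.
Import finmap.

Lemma card_eq_subset (T : Type) (A B : set (set T)) : finite_set B -> A `<=` B ->
  (A #= B)%card -> A = B.
Proof.
move=> fB AB; have fA := sub_finite_set AB fB.
move=> /(fcard_eq fA fB) e; apply/seteqP; split => // b Bb.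
have : fset_set A = fset_set B.
  have AB' : (fset_set A `<=` fset_set B)%fset by rewrite -fset_set_sub.
  by apply/eqP; rewrite -(fsubset_leqif_cards AB').2 e.
by move=> /(congr1 (fun X => b \in X)); rewrite !in_fset_set//;
  rewrite (mem_set Bb) => /set_mem.
Qed.

End CardEqSubset.

(** Read [d] as bounding a disc, and [N], [N0] as passing through the crossing. If neither [C1] nor
    [C2] were in [d], all loops of [ls] in [d] would occur in [ls0]. If [C1 = C2], replacing this
    loop by the loop [K0] of [N0] would inject the loops of [ls] in [d] into those of [ls0]. Both
    contradict the last hypothesis. *)
Lemma count_components (T : Type) (ls ls0 : set (set T)) (d N N0 : set (set T)) (C1 C2 : set T) :
  finite_set ls0 ->
  ls `\` N = ls0 `\` N0 -> N `<=` [set C1; C2] -> ls C1 -> ls0 `&` N0 !=set0 ->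
  (ls `\` d #= ls0 `\` d)%card -> ~ (ls `&` d #<= ls0 `&` d)%card ->
  C1 <> C2 /\ (d C1 \/ d C2).
Proof.
move=> f0 eN N12 lC1 [K0 [lK0 NK0]] hnc hc.
have sub K : ls K -> ~ N K -> ls0 K /\ ~ N0 K.
  by move=> lK nK; have : (ls0 `\` N0) K by rewrite -eN.
have dd : d C1 \/ d C2.
  apply: contrapT => nd; apply: hc; apply: subset_card_le => K [lK dK]; split => //.
  apply: (proj1 (sub _ lK _)) => /N12 [] e; apply: nd; rewrite -e; auto.
split => // e12; rewrite -e12 in N12 dd.
have {}dd : d C1 by case: dd.
have N1 K : N K -> K = C1 by move=> /N12 [].
(* The only loop of [ls] in [N] is in [d], so the loops outside [d] occur in [ls0]; having the same
   finite number, they are all those of [ls0] outside [d]. *)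
have hnc' : ls `\` d = ls0 `\` d.
  apply: card_eq_subset hnc; first exact: finite_setD.
  move=> K [lK dK]; split => //; apply: (proj1 (sub _ lK _)) => /N1 e.
  by apply: dK; rewrite e.
have dK0 : d K0.
  apply: contrapT => nd; have : (ls `\` d) K0 by rewrite hnc'.
  move=> [lsK0 _]; have [NK|nNK] := pselect (N K0).
    by apply: nd; rewrite (N1 _ NK).
  by have [_] := sub _ lsK0 nNK.
apply: hc.
pose f K := if pselect (K = C1) then K0 else K.
have fi : {in ls `&` d &, injective f}.
  have h K K' : ls K' -> K = C1 -> K' <> C1 -> K0 = K' -> False.
    move=> lK' _ K'n e; have nN : ~ N K' by move=> /N1.
    by have [_] := sub _ lK' nN; rewrite -e.
  move=> K K'; rewrite !inE /f => -[lK _] [lK' _].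
  case: pselect => [e|n]; case: pselect => [e'|n'] //.
  - by move=> _; exact: etrans e (esym e').
  - by move=> /(h K K' lK' e n').
  - by move=> /esym /(h K' K lK e' n).
rewrite -(card_le_eql (inj_card_eq fi)); apply: subset_card_le => _ [K [lK dK] <-].
rewrite /f; case: pselect => [_|n] //; split => //.
by apply: (proj1 (sub _ lK _)) => /N1.
Qed.

(** * State curves *)

Definition state_sign {R : realType} (m : smoothing) : R :=
  match m with ASmoothing => 1 | BSmoothing => -1 end.

Section Pieces.
Variables (R : realType) (Sigma : oriented_surface R) (D : link_diagram Sigma).
Implicit Types (i j : 'I_(ncomp D)) (s t u a : R) (x y z : crossing D) (l m : strand).

Local Notation off := (at_offset (period D) (passage D)).
Local Notation per := (period D).
Local Notation tau y l := (passage D y l).2.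
Local Notation comp y l := (passage D y l).1.

Lemma half_norm_lt1 u : `|u| <= 2^-1 -> `|u| < 1.
Proof. by move=> h; apply: le_lt_trans h _; lra. Qed.

Lemma strip_open : open (strip R).
Proof. by apply: open_lt_cont; cont. Qed.

Lemma ribbon_cont i t u : `|u| < 1 -> {for (t, u), continuous (ribbon D i)}.
Proof.
move=> u1; have := @ribbon_continuous _ _ D i; rewrite continuous_open_subspace.
  by apply; rewrite inE.
exact: strip_open.
Qed.

Lemma ribbon_path_within i (A : set R) (f : R -> R * R) : continuous f ->
  (forall t, A t -> `|(f t).2| < 1) -> {within A, continuous (fun t => ribbon D i (f t))}.
Proof.
move=> cf f1; apply/subspace_continuousP => t At.
have h : {for t, continuous (fun t => ribbon D i (f t))}.
  apply: continuous_comp; first exact: cf.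
  by move: (f1 t At); case: (f t) => p q; exact: ribbon_cont.
exact: cvg_within_filter.
Qed.

Lemma ribbon_path i a b (f : R -> R * R) : continuous f ->
  (forall t, a <= t <= b -> `|(f t).2| < 1) ->
  closed ((fun t => ribbon D i (f t)) @` `[a, b]) /\
  connected ((fun t => ribbon D i (f t)) @` `[a, b]).
Proof.
move=> cf f1; have cw : {within `[a, b], continuous (fun t => ribbon D i (f t))}.
  by apply: ribbon_path_within => // t /=; rewrite in_itv /=; exact: f1.
split.
- apply: compact_closed; first exact: surface_hausdorff.
  by apply: continuous_compact => //; exact: segment_compact.
- by apply: connected_continuous_connected => //; exact: segment_connected.
Qed.

(** The closed side, in the quadrant of signs [c1], [c2], of the diamond cut out by a smoothing. The
    signs are real numbers of square 1, to enter into computations. *)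
Definition quarter y (c1 c2 : R) :=
  (fun a => square y Over (c1 * a, c2 * (2^-1 - a))) @` `[0, 2^-1].

Lemma quarter_closed_connected y c1 c2 : `|c2| = 1 ->
  closed (quarter y c1 c2) /\ connected (quarter y c1 c2).
Proof.
move=> c21; apply: (@ribbon_path _ _ _ (fun a => (tau y Over + c1 * a, c2 * (2^-1 - a)))).
  by cont.
by move=> t /andP[t0 t1] /=; rewrite normrM c21 mul1r ger0_norm; lra.
Qed.

Lemma quarterP y c1 c2 (w : Sigma) : c1 * c1 = 1 -> c2 * c2 = 1 ->
  quarter y c1 c2 w <-> exists p : R * R, [/\ `|p.1| + `|p.2| = 2^-1,
    0 <= c1 * p.1, 0 <= c2 * p.2 & w = square y Over p].
Proof.
move=> h1 h2.
have n1 : `|c1| = 1 by apply/eqP; rewrite -sqr_norm_eq1 expr2 h1.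
have n2 : `|c2| = 1 by apply/eqP; rewrite -sqr_norm_eq1 expr2 h2.
split=> [[a /=]|[[p1 p2] [/= e a1 a2 ->]]].
  rewrite in_itv /= => /andP[a0 a1] <-.
  exists (c1 * a, c2 * (2^-1 - a)) => /=; split => //.
  - by rewrite !normrM n1 n2 !mul1r !ger0_norm; lra.
  - by rewrite mulrA h1 mul1r.
  - by rewrite mulrA h2 mul1r; lra.
exists (c1 * p1).
  rewrite /= in_itv /= a1 /= -(ger0_norm a1) normrM n1 mul1r.
  by have := normr_ge0 p2; lra.
have e2 : 2^-1 - c1 * p1 = c2 * p2.
  by rewrite -(ger0_norm a1) -(ger0_norm a2) !normrM n1 n2; lra.
by rewrite e2 !mulrA h1 h2 !mul1r.
Qed.

Lemma state_sign_sqr n : state_sign n * state_sign n = 1 :> R.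
Proof. by case: n; rewrite /= ?mulr1 ?mulrNN ?mulr1. Qed.

Definition bsign (b : bool) : R := if b then 1 else -1.

Lemma bsign_sqr b : bsign b * bsign b = 1.
Proof. by case: b; rewrite /= ?mulr1 ?mulrNN ?mulr1. Qed.

Lemma smoothing_arcsP y n (w : Sigma) : smoothing_arcs y n w <->
  exists p : R * R, [/\ `|p.1| + `|p.2| = 2^-1, state_sign n * (p.1 * p.2) <= 0 &
    w = square y Over p].
Proof.
split=> [[p [e h] <-]|[p [e h ->]]]; exists p => //.
  by split => //; move: h; case: n => /=; rewrite ?mul1r// mulN1r oppr_le0.
by split => //; move: h; case: n => /=; rewrite ?mul1r// mulN1r oppr_le0.
Qed.

Lemma smoothing_arcsE y n : smoothing_arcs y n =
  quarter y 1 (- state_sign n) `|` quarter y (-1) (state_sign n).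
Proof.
have s1 := state_sign_sqr n; have ns1 : - state_sign n * - state_sign n = 1 :> R by rewrite mulrNN.
have n11 : -1 * -1 = 1 :> R by rewrite mulrNN mulr1.
apply/seteqP; split=> w.
  move=> /smoothing_arcsP[p [e h ew]].
  have [p1|p1] := leP 0 p.1.
    have [p10|p10] := eqVneq p.1 0; last first.
      have {p1 p10}p1 : 0 < p.1 by rewrite lt_neqAle eq_sym p10.
      left; apply/quarterP; rewrite ?mulr1//; exists p; split => //; first by lra.
      by rewrite mulrCA pmulr_rle0// in h; lra.
    have [h2|h2] := leP 0 (- state_sign n * p.2).
      by left; apply/quarterP; rewrite ?mulr1//; exists p; split => //; lra.
    by right; apply/quarterP => //; exists p; split => //; lra.
  right; apply/quarterP => //; exists p; split => //; first by lra.
  by rewrite mulrCA nmulr_rle0// in h; lra.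
case=> /quarterP h; apply/smoothing_arcsP.
  have [||p [e p1 p2 ew]] := h => //; first by rewrite mulr1.
  by exists p; split => //; nra.
have [||p [e p1 p2 ew]] := h => //.
by exists p; split => //; nra.
Qed.

Lemma smoothing_arcs_closed y n : closed (@smoothing_arcs _ _ D y n).
Proof.
have n1 (c : R) : c * c = 1 -> `|c| = 1.
  by move=> cc; apply/eqP; rewrite -sqr_norm_eq1 expr2 cc.
rewrite smoothing_arcsE; apply: closedU.
  apply: (proj1 (quarter_closed_connected _ _ _)); apply: n1.
  by rewrite mulrNN state_sign_sqr.
by apply: (proj1 (quarter_closed_connected _ _ _)); apply: n1; exact: state_sign_sqr.
Qed.

(** Naming an edge by the passage where it starts makes the edges a finite family. *)
Definition next_time y l : R :=
  get [set s | exists y' l', edge (comp y l) (tau y l) y l s y' l'].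

Lemma next_timeP y l : exists y' l', edge (comp y l) (tau y l) y l (next_time y l) y' l'.
Proof.
by apply: (@getPex _ [set s | exists y' l', edge (comp y l) (tau y l) y l s y' l']);
  exact: edge_from.
Qed.

Lemma next_time_at z n t : exists y l (k : int), [/\ comp y l = comp z n,
  tau y l <= t + k%:~R * per (comp z n) & t + k%:~R * per (comp z n) < next_time y l].
Proof.
have [s [y [l [s' [y' [l' [he /andP[st ts]]]]]]]] := edge_at z n t.
have [_ [ei [k ek]] _ _] := he; rewrite addr0 in ek.
exists y, l, (- k); rewrite -ei mulrNz mulNr; split => //; first by rewrite ei in ek *; lra.
have [y1 [l1 he1]] := next_timeP y l.
have := edge_shift (- k) he; rewrite ek mulrNz mulNr addrK ei => he2.
(* The ends of both edges are not yet known to agree; the midpoint of [tau y l] and the smaller end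
   [m] is interior to both. *)
set m := Num.min (next_time y l) (s' - k%:~R * per (comp y l)).
have [h1 _ _ _] := he1; have [h2 _ _ _] := he2.
have m0 : tau y l < m by rewrite lt_min h1.
have m1 : m <= next_time y l by rewrite ge_min lexx.
have m2 : m <= s' - k%:~R * per (comp y l) by rewrite ge_min lexx orbT.
have [||_ e] := @edge_unique _ _ _ _ ((tau y l + m) / 2) _ _ _ _ _ _ _ _ _ _ _ _ he1 he2.
- by apply/andP; split; lra.
- by apply/andP; split; lra.
by rewrite e -ei ltrD2r.
Qed.

Definition segment y l :=
  (fun t => ribbon D (comp y l) (t, 0)) @` `[tau y l + 2^-1, next_time y l - 2^-1].

(** Empty when the component has a passage, so that every component can serve as an index. *)
Definition free_circle i :=
  [set p : Sigma | (forall y l, i <> comp y l) /\ exists t, p = ribbon D i (t, 0)].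

Lemma norm0_lt1 : `|0 : R| < 1. Proof. by rewrite normr0. Qed.

Lemma segment_closed_connected y l : closed (segment y l) /\ connected (segment y l).
Proof.
apply: (@ribbon_path _ _ _ (fun t => (t, 0))); first by cont.
by move=> t _; exact: norm0_lt1.
Qed.

Lemma free_circle_closed_connected i : closed (free_circle i) /\ connected (free_circle i).
Proof.
have [h|h] := pselect (forall y l, i <> comp y l); last first.
  have -> : free_circle i = set0 by apply/seteqP; split => // p [].
  by split; [exact: closed0|exact: connected0].
have -> : free_circle i = (fun t => ribbon D i (t, 0)) @` `[0, per i].
  apply/seteqP; split=> [_ [_ [t ->]]|_ [t _ <-]]; last by split => //; exists t.
  have P0 := per_gt0 i; have /andP[k1 k2] := floor_itv (t / per i).
  set k := Num.floor _ in k1 k2.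
  rewrite ler_pdivlMr// in k1; rewrite ltr_pdivrMr// intrD mulrDl mul1r in k2.
  exists (t + (- k)%:~R * per i); last by rewrite ribbon_shift// norm0_lt1.
  by rewrite /= in_itv /= mulrNz mulNr; apply/andP; split; lra.
apply: (@ribbon_path _ _ _ (fun t => (t, 0))); first by cont.
by move=> t _; exact: norm0_lt1.
Qed.

Lemma diagram_square y l p : `|p.1| < 1 -> `|p.2| < 1 ->
  diagram_curve D (square y l p) <-> p.1 * p.2 = 0.
Proof.
move=> p1 p2; split=> [h|/eqP].
  apply/eqP; rewrite mulf_eq0; apply: contrapT => /negP; rewrite negb_or => /andP[n1 n2].
  exact: (square_not_diagram p1 p2 n1 n2 h).
rewrite mulf_eq0 => /orP[/eqP e|/eqP e].
  rewrite square_other// e mulr0 oppr0; exists (comp y (other l)).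
  by eexists.
by rewrite /square e; exists (comp y l); eexists.
Qed.

Lemma off_diamond i s y l a : off i s y l a -> `|a| < 2^-1 ->
  (crossing_chart y @` [set p | `|p.1| + `|p.2| < 2^-1]) (ribbon D i (s, 0)).
Proof.
move=> o a1; rewrite (off_square norm0_lt1 o).
case: l o => o; first by exists (a, 0) => //=; rewrite normr0 addr0.
rewrite square_other/= ?normr0//; last exact: half_norm_lt1 (ltW a1).
exists (turn y Under * 0, - (turn y Under * a)) => //=.
by rewrite mulr0 normr0 add0r normrN normrM norm_turn mul1r.
Qed.

Lemma diamond_off i s y : (crossing_chart y @` [set p | `|p.1| + `|p.2| < 2^-1]) (ribbon D i (s, 0)) ->
  exists l a, off i s y l a /\ `|a| < 2^-1.
Proof.
move=> [[p1 p2] /= h e].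
have g1 := normr_ge0 p1; have g2 := normr_ge0 p2.
have q1 : `|p1| < 1 by lra.
have q2 : `|p2| < 1 by lra.
have [l [a [a1 o _ pe]]] := @ribbon_in_square _ _ _ i s 0 y (p1, p2) norm0_lt1 q1 q2 (esym e).
exists l, a; split => //; case: pe => [[_ [<- _]]|[_ [_ /= <-]]]; lra.
Qed.

(** The arcs at [x] are left out: two states that differ only at [x] have the same pieces, and
    [state_curveE] puts their whole difference in its last term. *)
Definition piece (S : state D) x (k : (crossing D * bool) + (crossing D * bool) + 'I_(ncomp D)) :=
  match k with
  | inl (inl (y, b)) => if y == x then set0 else quarter y (bsign b) (- bsign b * state_sign (S y))
  | inl (inr (y, b)) => segment y (if b then Over else Under)
  | inr i => free_circle i
  end.

Lemma piece_closed_connected S x k : closed (piece S x k) /\ connected (piece S x k).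
Proof.
case: k => [[[y b]|[y b]]|i] /=; last exact: free_circle_closed_connected.
  case: eqP => _; first by split; [exact: closed0|exact: connected0].
  apply: quarter_closed_connected.
  by apply/eqP; rewrite -sqr_norm_eq1 expr2 mulrACA mulrNN bsign_sqr state_sign_sqr mulr1.
exact: segment_closed_connected.
Qed.

Lemma segment_not_diamond y l t : tau y l + 2^-1 <= t <= next_time y l - 2^-1 ->
  forall z, ~ (crossing_chart z @` [set p | `|p.1| + `|p.2| < 2^-1]) (ribbon D (comp y l) (t, 0)).
Proof.
move=> /andP[t1 t2] z /diamond_off[n [a [ho a1]]].
have [y' [l' he]] := next_timeP y l.
have ts : tau y l < t < next_time y l by apply/andP; split; lra.
have eo := edge_offset he ts (half_norm_lt1 (ltW a1)) ho.
move: a1; rewrite ltr_norml => /andP[g1 g2].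
by case: eo => -[h1 h2 _ _]; lra.
Qed.

Lemma diagram_minus_diamonds :
  diagram_curve D `\` \bigcup_(y in [set: crossing D])
       (crossing_chart y @` [set p | `|p.1| + `|p.2| < 2^-1]) =
  (\bigcup_(q in [set: crossing D * bool]) segment q.1 (if q.2 then Over else Under)) `|`
  \bigcup_(i in [set: 'I_(ncomp D)]) free_circle i.
Proof.
apply/seteqP; split=> [_ [[i [t ->]] nd]|w].
  have [h|/existsNP[y /existsNP[l /contrapT ei]]] := pselect (forall y l, i <> comp y l).
    by right; exists i => //; split => //; exists t.
  left; have [z [n [k [e k1 k2]]]] := next_time_at y l t.
  exists (z, if n is Over then true else false) => //=.
  have -> : (if (if n is Over then true else false) then Over else Under) = n by case: (n).
  rewrite -e in k1 k2; rewrite ei -e; rewrite ei -e in nd.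
  set t' := t + k%:~R * per (comp z n) in k1 k2.
  have et : ribbon D (comp z n) (t, 0) = ribbon D (comp z n) (t', 0).
    by rewrite ribbon_shift// norm0_lt1.
  rewrite et in nd *; exists t' => //=; rewrite in_itv /=.
  have [y' [l' he]] := next_timeP z n; have [h1 h2 h3 _] := he.
  apply/andP; split; rewrite leNgt; apply/negP => h; apply: nd.
    exists z => //; apply: (@off_diamond _ _ _ n (t' - tau z n)); last by rewrite ger0_norm; lra.
    by have := off_passage z n (t' - tau z n); rewrite addrC subrK.
  exists y' => //; apply: (@off_diamond _ _ _ l' (t' - next_time z n)).
    by have := off_add (t' - next_time z n) h3; rewrite add0r addrC subrK.
  by rewrite ler0_norm; lra.
case=> [[[y b] _ /= [t]]|[i _ [h [t ->]]]].
  rewrite /= in_itv /= => ht <-; split; first by exists (comp y (if b then Over else Under)), t.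
  by move=> [z _]; exact: segment_not_diamond.
split; first by exists i, t.
by move=> [z _] /diamond_off[l [a [[ei _] _]]]; exact: h ei.
Qed.

Lemma state_curveE S x : state_curve S = \bigcup_k piece S x k `|` smoothing_arcs x (S x).
Proof.
rewrite /state_curve diagram_minus_diamonds.
apply/seteqP; split=> w.
  case=> [[[[y b] _ h]|[i _ h]]|[y _ h]].
  - by left; exists (inl (inr (y, b))).
  - by left; exists (inr i).
  have [e|/eqP ne] := eqVneq y x; first by right; rewrite -e.
  left; move: h; rewrite smoothing_arcsE => -[h|h].
    by exists (inl (inl (y, true))) => //=; case: eqP => // _; rewrite mulN1r.
  by exists (inl (inl (y, false))) => //=; case: eqP => // _; rewrite opprK mul1r.
case=> [[[[[y b]|[y b]]|i] _ /= h]|h].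
- move: h; case: eqP => // _ h; right; exists y => //; rewrite smoothing_arcsE.
  by case: b h => /=; rewrite ?mulN1r ?opprK ?mul1r; [left|right].
- by left; left; exists (y, b).
- by left; right; exists i.
- by right; exists x.
Qed.

(** A piece can meet the sides of the diamond at [x] only in its four corners, which belong to both
    smoothings. *)
Lemma piece_smoothing_arcs S x n n' :
  (\bigcup_k piece S x k) `&` smoothing_arcs x n `<=` smoothing_arcs x n'.
Proof.
move=> w [[k _ hk] /smoothing_arcsP [p [e h ew]]].
apply/smoothing_arcsP; exists p; split => //.
have p1 : `|p.1| < 1 by apply: half_norm_lt1; have := normr_ge0 p.2; lra.
have p2 : `|p.2| < 1 by apply: half_norm_lt1; have := normr_ge0 p.1; lra.
suff : diagram_curve D w by rewrite ew => /(diagram_square _ _ p1 p2) ->; rewrite mulr0.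
have hd : (diagram_curve D `\` \bigcup_(y in [set: crossing D])
       (crossing_chart y @` [set p | `|p.1| + `|p.2| < 2^-1])) w -> diagram_curve D w.
  by case.
case: k hk => [[[y b]|[y b]]|i] /= hk.
- move: hk; case: eqP => // yx /quarterP [||q [eq _ _ ewq]].
  + exact: bsign_sqr.
  + by rewrite mulrACA mulrNN bsign_sqr state_sign_sqr mulr1.
  have q1 : `|q.1| < 1 by apply: half_norm_lt1; have := normr_ge0 q.2; lra.
  have q2 : `|q.2| < 1 by apply: half_norm_lt1; have := normr_ge0 q.1; lra.
  by rewrite ew in ewq; have [/esym] := square_eq p1 p2 q1 q2 ewq.
- by apply: hd; rewrite diagram_minus_diamonds; left; exists (y, b).
- by apply: hd; rewrite diagram_minus_diamonds; right; exists i.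
Qed.

End Pieces.

(** * Sides of a disc, and components with a single passage *)

Lemma connected_split (T : topologicalType) (Q A B : set T) : connected Q ->
  open A -> open B -> Q `<=` A `|` B -> Q `&` A `&` B = set0 -> Q `&` A !=set0 -> Q `<=` A.
Proof.
move=> Qc Ao Bo QAB AB0 QA0.
suff : Q `&` A = Q by move=> <- q [].
apply: Qc => //; first by exists A.
exists (~` B); first exact: open_closedC.
apply/seteqP; split=> q [Qq h]; split => //.
  by move=> Bq; have : (Q `&` A `&` B) q by []; rewrite AB0.
by case: (QAB q Qq) => // /h.
Qed.

Section DiscSides.
Variables (R : realType) (X : topologicalType).
Hypothesis Xh : hausdorff_space X.

(** [U] is the interior of the disc. Moving towards the centre shows that every point of [L] is a
    limit of points of [U]; by the last clause, which is [boundary_not_interior], there are also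
    points outside the disc nearby. *)
Lemma disc_sides (L : set X) : bounds_disc R L -> exists U : set X,
  [/\ open U, closed (U `|` L), U `&` L = set0,
      forall z W, L z -> nbhs z W -> W `&` U !=set0 &
      forall (V : set (R * R)) f p0, open V -> V p0 -> open_embedding V f -> L (f p0) ->
        ~ nbhs (f p0) (U `|` L)].
Proof.
move=> [e [ce ei eL eo]]; exists (e @` open_disc (0, 0) 1).
have oc (p : R * R) : open_disc (0, 0) 1 p -> closed_disc (0, 0) 1 p by move=> /ltW.
have cc (p : R * R) : circle (0, 0) 1 p -> closed_disc (0, 0) 1 p.
  by rewrite /circle /closed_disc /= => ->.
have KE : e @` open_disc (0, 0) 1 `|` L = e @` closed_disc (0, 0) 1.
  rewrite -eL; apply/seteqP; split=> [w [[p hp <-]|[p hp <-]]|w [p hp <-]].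
  - by exists p => //; exact: oc.
  - by exists p => //; exact: cc.
  - move: hp; rewrite /closed_disc /= le_eqVlt => /orP[/eqP h|h]; [right|left]; by exists p.
split => //.
- rewrite KE; apply: compact_closed => //; apply: continuous_compact => //.
  exact: disc_compact.
- apply/seteqP; split => // w [[p hp <-]]; rewrite -eL => -[q hq /ei].
  rewrite !inE => /(_ (cc _ hq) (oc _ hp)) qp.
  by move: hq hp; rewrite qp /circle /open_disc /= => ->; rewrite ltxx.
- move=> z W; rewrite -eL => -[b hb <-] nW.
  have /nbhs_ballP[d /= d0 bd] := within_nbhs ce (cc _ hb) nW.
  pose d' := Num.min (d / 2) (1 / 2); pose p := ((1 - d') * b.1, (1 - d') * b.2).
  have d'0 : 0 < d' by rewrite lt_min; apply/andP; split; lra.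
  have d'1 : d' <= 1 / 2 by rewrite ge_min lexx orbT.
  have d'd : d' <= d / 2 by rewrite ge_min lexx.
  have hb' : b.1 ^+ 2 + b.2 ^+ 2 = 1 by move: hb; rewrite /circle /= !subr0 expr1n.
  have op : open_disc (0, 0) 1 p.
    rewrite /open_disc /p /= !subr0 !exprMn -mulrDr hb' expr1n mulr1.
    by rewrite expr_lt1//; lra.
  exists (e p); split; last by exists p.
  apply: bd; last exact: oc.
  have b1 : `|b.1| <= 1 by rewrite ler_norml; nra.
  have b2 : `|b.2| <= 1 by rewrite ler_norml; nra.
  have near (c : R) : `|c| <= 1 -> `|c - (1 - d') * c| < d.
    move=> c1; have -> : c - (1 - d') * c = d' * c by ring.
    rewrite normrM gtr0_norm//; nra.
  by split; rewrite /ball /=; exact: near.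
- move=> V f p0 Vo Vp fe; rewrite -{1}eL => -[b hb eb].
  rewrite KE; exact: (boundary_not_interior Xh ce ei hb Vo Vp fe (esym eb)).
Qed.

(** [Q] meets the interior of the disc near [f p0], hence stays inside, and then the disc would be a
    neighbourhood of a point of its boundary. *)
Lemma disc_two_sided (L Q : set X) (V : set (R * R)) f p0 : bounds_disc R L ->
  open V -> V p0 -> open_embedding V f -> L (f p0) ->
  connected Q -> Q `&` L = set0 -> f @` V `<=` Q `|` L -> False.
Proof.
move=> /disc_sides[U [Uo Kc UL nU nK]] Vo Vp fe Lp Qc QL fQL.
apply: (nK V f p0 Vo Vp fe Lp).
have nV : nbhs (f p0) (f @` V).
  exact: embedding_nbhsT.
apply: (filterS _ nV) => w fw; case: (fQL w fw) => [Qw|]; last by right.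
left; apply: (connected_split Qc Uo (closed_openC Kc)) => //.
- move=> q Qq; have [Uq|nUq] := pselect (U q); first by left.
  by right => -[//|Lq]; have : (Q `&` L) q by []; rewrite QL.
- by apply/seteqP; split => // q [[_ Uq] /(_ (or_introl Uq))].
- have [v [fv Uv]] := nU _ _ Lp nV; exists v; split => //.
  case: (fQL v fv) => // Lv; have : (U `&` L) v by []; rewrite UL //.
Qed.

(** Near [f p0] there are points inside and points outside the disc. The chart joins them in the
    space, but a connected set that avoids [L] cannot leave the interior of the disc. *)
Lemma disc_separates (L : set X) (V : set (R * R)) f p0 : bounds_disc R L ->
  open V -> V p0 -> open_embedding V f -> connected (f @` V) -> L (f p0) ->
  separates L.
Proof.
move=> /disc_sides[U [Uo Kc UL nU nK]] Vo Vp fe fc Lp.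
have nV : nbhs (f p0) (f @` V).
  exact: embedding_nbhsT.
have [p [fp Up]] := nU _ _ Lp nV.
have [q [fq nq]] : exists q, (f @` V) q /\ ~ (U `|` L) q.
  apply: contrapT => h; apply: (nK V f p0 Vo Vp fe Lp).
  by apply: (filterS _ nV) => w fw; apply: contrapT => nw; apply: h; exists w.
have nLp : ~ L p by move=> Lp'; have : (U `&` L) p by []; rewrite UL.
exists p, q; split => //; first by move=> Lq; apply: nq; right.
  by apply: (connected_component_max fp) => //.
move=> pq; have UC : connected_component (~` L) p `<=` U.
  apply: (connected_split (@component_connected _ _ _) Uo (closed_openC Kc)).
  - move=> w /connected_component_sub nLw.
    have [Uw|nUw] := pselect (U w); first by left.
    by right => -[].
  - by apply/seteqP; split => // w [[_ Uw] /(_ (or_introl Uw))].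
  - by exists p; split => //; exact: connected_component_refl.
by apply: nq; left; exact: UC.
Qed.

End DiscSides.

(** * Edges that close up after a single passage *)

Section OddEdge.
Variables (R : realType) (Sigma : oriented_surface R) (D : link_diagram Sigma).
Implicit Types (i j : 'I_(ncomp D)) (s t u a : R) (x y z : crossing D) (l m : strand).

Local Notation off := (at_offset (period D) (passage D)).
Local Notation per := (period D).
Local Notation tau y l := (passage D y l).2.
Local Notation comp y l := (passage D y l).1.

Lemma strand_sign_sqr l : strand_sign l * strand_sign l = 1 :> R.
Proof. by case: l; rewrite /= ?mulr1 ?mulrNN ?mulr1. Qed.

Lemma ribbon_embedding i (V : set (R * R)) : open V ->
  (forall p, V p -> `|p.2| < 1) ->
  (forall p q, V p -> V q -> ribbon D i p = ribbon D i q -> p = q) ->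
  open_embedding V (ribbon D i).
Proof.
move=> Vo V1 Vi; split.
- apply: (continuous_subspaceW _ (@ribbon_continuous _ _ D i)) => -[t u] /V1 //.
- by move=> p q; rewrite !inE; exact: Vi.
- move=> U Uo; apply: ribbon_open; first exact: openI.
  by move=> [t u] [/V1].
Qed.

Lemma int_small (k : int) : `|k%:~R : R| < 1 -> k = 0.
Proof.
by rewrite -intr_norm ltrz1 => h; apply/eqP; rewrite -normr_le0 -ltzD1 add0r.
Qed.

Lemma odd_segment_avoids (S : state D) y l (L : set Sigma) :
  components (state_curve S) L -> bounds_disc R L ->
  next_time y l = tau y l + per (comp y l) -> segment y l `&` L = set0.
Proof.
move=> hL dL odd; have [y' [l' he]] := next_timeP y l; rewrite odd in he.
set i := comp y l in he odd; set s := tau y l in he odd; set P := per i in he odd.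
have P2 : 2 <= P by have := edge_length he; rewrite addrAC subrr add0r lexx andbT.
have [_ _ oddP] := odd_edge he.
apply/seteqP; split => // w0 [sw0 Lw0].
have segL : segment y l `<=` L.
  apply: (components_absorb hL); first by case: (segment_closed_connected y l).
    rewrite (state_curveE S y) => w sw; left.
    by exists (inl (inr (y, if l is Over then true else false))) => //; case: (l) sw.
  by exists w0.
have [sg esg] : exists sg : R, sg = state_sign (S y) * strand_sign l by eexists.
have sg2 : sg * sg = 1 by rewrite esg mulrACA state_sign_sqr strand_sign_sqr mulr1.
(* The arcs of S at y avoid two opposite quadrants. Followed once around the
   component, these two quadrants reach both sides of the middle of the edge. *)
pose Q0 : set (R * R) := [set p | p = (0, 0) \/
  [/\ `|p.1| <= 5 / 8 * P, `|p.2| <= 2^-1 & 0 < sg * (p.1 * p.2)]].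
pose g (p : R * R) := ribbon D i (s + p.1, p.2).
have Q01 p : Q0 p -> `|p.2| <= 2^-1.
  by case=> [->|[]//] /=; rewrite normr0; lra.
have Qconn : connected (g @` Q0).
  have -> : g @` Q0 = \bigcup_(p in Q0) ((fun t => ribbon D i (s + t * p.1, t * p.2)) @` `[0, 1]).
    apply/seteqP; split=> [_ [p Qp <-]|w [p Qp [t]]].
      by exists p => //; exists 1; rewrite /= ?in_itv /= ?lexx ?ler01// !mul1r.
    rewrite /= in_itv /= => /andP[t0 t1] <-; exists (t * p.1, t * p.2) => //.
    case: Qp => [->|[q1 q2 q3]]; first by left; rewrite !mulr0.
    have [->|tn] := eqVneq t 0; first by left; rewrite !mul0r.
    have tp : 0 < t by rewrite lt_neqAle eq_sym tn.
    right; rewrite /= !normrM (ger0_norm t0); split.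
    - by apply: le_trans q1; rewrite ler_piMl.
    - by apply: le_trans q2; rewrite ler_piMl.
    - have -> : sg * (t * p.1 * (t * p.2)) = t * t * (sg * (p.1 * p.2)) by ring.
      by apply: mulr_gt0 => //; exact: mulr_gt0.
  apply: bigcup_connected.
    exists (ribbon D i (s, 0)) => p Qp; exists 0; rewrite /= ?in_itv /= ?lexx ?ler01//.
    by rewrite !mul0r addr0.
  move=> p Qp; apply: (proj2 (@ribbon_path _ _ _ i 0 1 (fun t => (s + t * p.1, t * p.2)) _ _)).
    by cont.
  move=> t /andP[t0 t1] /=; rewrite normrM (ger0_norm t0); have := Q01 p Qp.
  by have := normr_ge0 p.2; nra.
have QL : g @` Q0 `&` state_curve S = set0.
  apply/seteqP; split => // w [[p Qp <-]] sc.
  have p21 : `|p.2| < 1 by exact: half_norm_lt1 (Q01 p Qp).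
  case: Qp => [pE|[p1 p2 p3]].
    rewrite pE /g /= addr0 in sc.
    case: sc => [[_ nd]|[z _ /smoothing_arcsP[q [q1 _ eq]]]].
      apply: nd; exists y => //; apply: (@off_diamond _ _ _ i s y l 0); last by rewrite normr0; lra.
      by have := off_passage y l 0; rewrite addr0.
    have r1 : `|q.1| < 1 by apply: half_norm_lt1; have := normr_ge0 q.2; lra.
    have r2 : `|q.2| < 1 by apply: half_norm_lt1; have := normr_ge0 q.1; lra.
    have eq' : square y l (0, 0) = square z Over q by rewrite -eq /square /= addr0.
    have [_ qE] := square_eq (p := (0, 0)) (@norm0_lt1 R) (@norm0_lt1 R) r1 r2 eq'.
    by case: qE q1 => [[_ <-]|[_ ->]] /=; rewrite ?mulr0 ?oppr0 !normr0; lra.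
  have n1 : p.1 != 0 by apply: contraTneq p3 => ->; rewrite mul0r mulr0 ltxx.
  have n2 : p.2 != 0 by apply: contraTneq p3 => ->; rewrite !mulr0 ltxx.
  (* The occurrences of the only passage are multiples of [P] apart, and [Q0] stays within
     [5 / 8 * P < P] of one of them. *)
  have key r z (n : strand) : off i r z n 0 -> `|r - s| <= 5 / 8 * P -> r = s.
    move=> /oddP[_ [_ [k ->]]]; rewrite [s + _]addrC addrK -/P normrM (@ger0_norm _ P); last by lra.
    move=> h; rewrite (@int_small k) ?mul0r ?add0r//.
    by have : 0 < P by [lra|]; nra.
  case: sc => [[dw _]|[z _ /smoothing_arcsP[q [q1 q2 eq]]]].
    have [z [n ho]] := strip_not_diagram p21 n2 dw.
    have e : s + p.1 = s by apply: (key _ _ _ ho); rewrite [s + _]addrC addrK.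
    by case/eqP: n1; lra.
  have r1 : `|q.1| < 1 by apply: half_norm_lt1; have := normr_ge0 q.2; lra.
  have r2 : `|q.2| < 1 by apply: half_norm_lt1; have := normr_ge0 q.1; lra.
  have [n [a [a1 ho es ea]]] := ribbon_in_square p21 r1 r2 eq.
  have a2 : `|a| <= 2^-1.
    have g1 := normr_ge0 q.1; have g2 := normr_ge0 q.2.
    by case: ea => [[_ eqa]|[_ [_ <-]]]; [move: q1 g2; rewrite eqa /= => q1 g2|]; lra.
  have [zy [nl [k ek]]] := oddP _ _ _ (off_sub ho).
  have k0 : k = 0.
    apply: int_small; rewrite -/P in ek; have ekP : k%:~R * P = p.1 - a by lra.
    have : `|k%:~R * P| <= 5 / 8 * P + 2^-1.
      by rewrite ekP; apply: le_trans (ler_normB _ _) _; lra.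
    by rewrite normrM (@ger0_norm _ P); [nra|lra].
  rewrite k0 mul0r addr0 in ek; have {}ek : a = p.1 by lra.
  move: q2 p3; rewrite -es zy nl ek esg mulrA.
  by rewrite leNgt => /negbTE ->.
have sgn : sg != 0 by apply: contraTneq (oner_neq0 R) => e; rewrite -sg2 e mul0r eqxx.
(* [V] is the part of the band between 3/8 and 5/8 of the edge. [Q0] reaches one side of it
   forwards, up to [5 / 8 * P], and the other side backwards, since 3/8 - 1 = -5/8. *)
pose V : set (R * R) := [set p | `|p.1 - (s + P / 2)| < P / 8 /\ `|p.2| < 2^-1].
have Vo : open V by apply: openI; apply: open_lt_cont; cont.
have Vs p : V p -> s + 3 / 8 * P < p.1 < s + 5 / 8 * P.
  by move=> [/ltr_normlP[h1 h2] _]; apply/andP; split; lra.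
have V1 p : V p -> `|p.2| < 1 by move=> [_ h]; exact/half_norm_lt1/ltW.
apply: (@disc_two_sided R _ (@surface_hausdorff _ Sigma) L (g @` Q0) V (ribbon D i) (s + P / 2, 0)) => //.
- by split; rewrite /= ?subrr normr0; lra.
- apply: ribbon_embedding => // p q Vp Vq; case: p Vp => t u Vp; case: q Vq => t' u' Vq e.
  have /= u1 := V1 _ Vp; have /= u1' := V1 _ Vq.
  have /= /andP[t1 t2] := Vs _ Vp; have /= /andP[t3 t4] := Vs _ Vq.
  have [[_ <- [k ek]]|[z [n [a [a1 ho _ eu]]]]] := ribbon_coincide u1 u1' e.
    suff k0 : k = 0 by rewrite ek k0 mul0r addr0.
    apply: int_small; have : `|k%:~R * P| < P / 4.
      by rewrite (_ : k%:~R * P = t' - t) ?ltr_norml; [apply/andP; split|rewrite -/P in ek]; lra.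
    by rewrite normrM (@ger0_norm _ P); [nra|lra].
  have ts : s < t < s + P by apply/andP; split; lra.
  have eo := edge_offset he ts a1 ho.
  have : `|a| < 2^-1.
    by case: Vq => _ /=; rewrite eu normrN normrM norm_turn mul1r.
  by rewrite ltr_norml => /andP[g1 g2]; exfalso; case: eo => -[h1 h2 _ _]; lra.
- apply: segL; exists (s + P / 2) => //=; rewrite in_itv /= odd -/s -/i -/P.
  by apply/andP; split; lra.
- apply/seteqP; split => // w [Qw Lw]; rewrite -QL; split => //.
  exact: components_sub hL _ Lw.
- move=> _ [[t u] Vp <-]; have /= /andP[t1 t2] := Vs _ Vp.
  have /= u1 := V1 _ Vp; have [u0|un] := eqVneq u 0.
    right; apply: segL; exists t; last by rewrite u0.
    by rewrite /= in_itv /= odd -/s -/i -/P; apply/andP; split; lra.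
  left; have u2 : `|u| <= 2^-1 by case: Vp => _ /ltW.
  have [h|h] := ltP 0 (sg * ((t - s) * u)).
    exists (t - s, u); last by rewrite /g /= addrC subrK.
    by right; split => //=; rewrite ger0_norm; lra.
  exists (t - s - P, u); last first.
    rewrite /g /= -[RHS](@ribbon_shift _ _ _ i t u (-1) u1); congr (ribbon D i (_, _)).
    by rewrite mulN1r -/P; ring.
  right; split => //=; first by rewrite ler0_norm; lra.
  have su : sg * u < 0.
    rewrite lt_neqAle mulf_neq0//= -(@pmulr_rle0 _ (t - s)); last by lra.
    by rewrite mulrCA.
  by rewrite mulrCA nmulr_rgt0//; lra.
Qed.

End OddEdge.

(** * Pushing edges off the diagram *)

Section PushEdges.
Variables (R : realType) (Sigma : oriented_surface R) (D : link_diagram Sigma).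
Implicit Types (i j : 'I_(ncomp D)) (s t u a : R) (x y z : crossing D) (l n : strand).

Local Notation off := (at_offset (period D) (passage D)).
Local Notation per := (period D).
Local Notation tau y l := (passage D y l).2.
Local Notation comp y l := (passage D y l).1.

(* Distinct patches are disjoint: in a crossing square, a point of a patch has
   a coordinate greater than 3/8 along the edge and one less than 1/8 across. *)
Definition edge_patch y l : set (R * R) :=
  [set p | tau y l + 3 / 8 < p.1 < next_time y l - 3 / 8 /\ `|p.2| < 1 / 8].

(** Equal to 1/16 on the whole segment, which starts 1/2 away from the passages, and nonpositive
    within 7/16 of them. As 3/8 < 7/16 and 1/16 < 1/8, the tent of this profile is supported inside
    the patch. *)
Definition edge_bump y l t : R :=
  Num.min (1 / 16) (Num.min (t - (tau y l + 7 / 16)) (next_time y l - 7 / 16 - t)).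

Lemma edge_patch_open y l : open (edge_patch y l).
Proof.
have -> : edge_patch y l = [set p | tau y l + 3 / 8 < p.1] `&`
    [set p | p.1 < next_time y l - 3 / 8] `&` [set p | `|p.2| < 1 / 8].
  by apply/seteqP; split=> p; [case=> /andP[]|case=> -[h1 h2 h3]; split => //; apply/andP].
by apply: openI; [apply: openI|]; apply: open_lt_cont; cont.
Qed.

Lemma edge_patch_strip y l p : edge_patch y l p -> `|p.2| < 1.
Proof. by case=> _ h; lra. Qed.

Lemma edge_patch_edge y l p : edge_patch y l p -> tau y l < p.1 < next_time y l.
Proof. by case=> /andP[h1 h2] _; apply/andP; split; lra. Qed.

Lemma edge_patch_off y l p z n a : edge_patch y l p -> `|a| < 1 ->
  off (comp y l) p.1 z n a -> 3 / 8 < `|a|.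
Proof.
move=> hp a1 ho; have [y' [l' he]] := next_timeP y l.
have eo := edge_offset he (edge_patch_edge hp) a1 ho.
case: hp => /andP[h1 h2] _; case: eo => -[a0 e _ _]; first by rewrite gtr0_norm; lra.
by rewrite ltr0_norm; lra.
Qed.

Lemma edge_patch_inj y l z n p q : edge_patch y l p -> edge_patch z n q ->
  ribbon D (comp y l) p = ribbon D (comp z n) q -> [/\ y = z, l = n & p = q].
Proof.
case: p q => [t u] [t' u'] hp hq e.
have /= u1 := edge_patch_strip hp; have /= u1' := edge_patch_strip hq.
have [[ei eu [k ek]]|[x [m [a [a1 ho _ eu]]]]] := ribbon_coincide u1 u1' e; last first.
  exfalso; have := edge_patch_off hp a1 ho; case: hq => _ /=; clear e hp.
  by rewrite eu normrN normrM norm_turn mul1r => h1 h2; lra.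
have [y' [l' he]] := next_timeP y l; have [z' [n' he']] := next_timeP z n.
have /= /andP[t1 t2] := edge_patch_edge hp; have /= /andP[t3 t4] := edge_patch_edge hq.
have he2 := edge_shift k he; rewrite ei in he2.
have t1' : tau y l + k%:~R * per (comp z n) < t' < next_time y l + k%:~R * per (comp z n).
  by rewrite ek ei; apply/andP; split; lra.
have t3' : tau z n < t' < next_time z n by rewrite t3.
have [es es'] := edge_unique he2 he' t1' t3'.
have [_ o1 _ _] := he2; have [_ o2 _ _] := he'; rewrite es in o1.
have [yz ln] := off0_inj o1 o2; split => //.
move: es; rewrite -yz -ln -[RHS]addr0 => /addrI/eqP; rewrite mulf_eq0 intr_eq0.
by rewrite (gt_eqF (per_gt0 _)) orbF => /eqP k0; rewrite ek k0 mul0r addr0 eu.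
Qed.

Lemma edge_patch_embedding y l : open_embedding (edge_patch y l) (ribbon D (comp y l)).
Proof.
apply: ribbon_embedding; [exact: edge_patch_open|exact: edge_patch_strip|].
by move=> p q hp hq /(edge_patch_inj hp hq)[].
Qed.

Lemma edge_bump_continuous y l : continuous (edge_bump y l).
Proof. by rewrite /edge_bump; cont. Qed.

Lemma push_edge y l (k : R) : `|k| < 1 -> exists h, [/\ homeomorphism h,
  forall p, edge_patch y l p -> edge_patch y l (tent k (edge_bump y l) p) /\
    h (ribbon D (comp y l) p) = ribbon D (comp y l) (tent k (edge_bump y l) p) &
  forall w, ~ (ribbon D (comp y l) @` edge_patch y l) w -> h w = w].
Proof.
move=> k1.
have cb : continuous (edge_bump y l) by exact: edge_bump_continuous.
have bnd p : `|p.2| <= edge_bump y l p.1 ->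
    [/\ `|p.2| <= 1 / 16, tau y l + 7 / 16 <= p.1 & p.1 <= next_time y l - 7 / 16].
  rewrite /edge_bump !le_min => /and3P[h1 h2 h3]; have := normr_ge0 p.2.
  by split; lra.
apply: chart_tent => //.
- exact: surface_hausdorff.
- exact: edge_patch_open.
- exact: edge_patch_embedding.
- have c1 : compact (`[tau y l, next_time y l]%classic `*` `[-1, 1]%classic : set (R * R)).
    by apply: compact_setX; exact: segment_compact.
  apply: subclosed_compact c1 _.
    apply: closed_le_cont; first by cont.
    by apply: (cont_comp cb); cont.
  move=> p /bnd[h1 h2 h3]; move: h1; rewrite ler_norml => /andP[h1 h4].
  by split; rewrite /= in_itv /=; apply/andP; split; lra.
- by move=> p /bnd[h1 h2 h3]; split; [apply/andP; split|]; lra.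
Qed.

Definition strand_of (b : bool) := if b then Over else Under.

Lemma strand_ofK l : exists b, strand_of b = l.
Proof. by case: l; [exists true|exists false]. Qed.

Lemma strand_of_inj : injective strand_of. Proof. by move=> [] []. Qed.

(** As the patches are disjoint, the homeomorphisms of the single edges can be composed, each acting
    alone on its patch. *)
Lemma push_edges (k : crossing D -> strand -> R) : (forall y l, `|k y l| < 1) ->
  exists h, [/\ homeomorphism h,
  forall y l p, edge_patch y l p -> edge_patch y l (tent (k y l) (edge_bump y l) p) /\
    h (ribbon D (comp y l) p) = ribbon D (comp y l) (tent (k y l) (edge_bump y l) p) &
  forall w, (forall y l, ~ (ribbon D (comp y l) @` edge_patch y l) w) -> h w = w].
Proof.
move=> k1.
pose f (q : crossing D * bool) := ribbon D (comp q.1 (strand_of q.2)).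
pose V (q : crossing D * bool) := edge_patch q.1 (strand_of q.2).
pose T (q : crossing D * bool) := tent (k q.1 (strand_of q.2)) (edge_bump q.1 (strand_of q.2)).
suff [h [hh h1 h2]] : exists h, [/\ homeomorphism h,
    forall q, q \in enum {: crossing D * bool} -> forall p, V q p -> V q (T q p) /\ h (f q p) = f q (T q p) &
    forall w, (forall q, q \in enum {: crossing D * bool} -> ~ (f q @` V q) w) -> h w = w].
  exists h; split => //.
    move=> y l p; have [b <-] := strand_ofK l => hp.
    by apply: (h1 (y, b)) => //; rewrite mem_enum.
  by move=> w hw; apply: h2 => q _; exact: hw.
have : uniq (enum {: crossing D * bool}) by exact: enum_uniq.
elim: (enum _) => [_|q0 r IH /= /andP[q0r /IH[h [hh h1 h2]]]].
  by exists id; split => //; exact: homeomorphism_id.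
have [h0 [hh0 h01 h02]] := push_edge q0.1 (strand_of q0.2) (k1 q0.1 (strand_of q0.2)).
have disj q q' p p' : V q p -> V q' p' -> f q p = f q' p' -> q = q'.
  by case: q q' => [y b] [z c] hp hq /(edge_patch_inj hp hq)[/= -> /strand_of_inj ->].
exists (fun w => h (h0 w)); split; first exact: homeomorphism_comp.
- move=> q; rewrite inE => /orP[/eqP ->|qr] p hp.
    have [Vt e] := h01 _ hp; split => //; rewrite e; apply: h2 => q' q'r [p' hp' e'].
    by move: q0r; rewrite -(disj _ _ _ _ hp' Vt e') q'r.
  have [Vt e] := h1 q qr p hp; split => //; rewrite h02//.
  by move=> [p' hp' e']; move: q0r; rewrite (disj _ _ _ _ hp' hp e') qr.
- move=> w hw; rewrite h02; last by apply: (hw q0); rewrite inE eqxx.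
  by apply: h2 => q qr; apply: hw; rewrite inE qr orbT.
Qed.

Lemma edge_patch_not_diagram y l p : edge_patch y l p -> p.2 != 0 ->
  ~ diagram_curve D (ribbon D (comp y l) p).
Proof.
move=> hp p2; have := edge_patch_strip hp; have := edge_patch_edge hp.
case: p hp p2 => [t u] /= hp p2 ht u1 /(strip_not_diagram u1 p2)[z [n ho]].
by have [y' [l' [_ _ _ /(_ _ _ _ ht)]]] := next_timeP y l; apply; exact: ho.
Qed.

Lemma push_off_diagram (m : smoothing) : alternating D -> exists h, [/\ homeomorphism h,
  forall y l t, next_time y l <> tau y l + per (comp y l) ->
    tau y l + 2^-1 <= t <= next_time y l - 2^-1 ->
    ~ diagram_curve D (h (ribbon D (comp y l) (t, 0))),
  forall y p, `|p.1| < 1 -> `|p.2| < 1 -> state_sign m * (p.1 * p.2) < 0 ->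
    ~ diagram_curve D (h (square y Over p)) &
  forall y p, `|p.1| <= 3 / 8 -> `|p.2| <= 3 / 8 -> h (square y Over p) = square y Over p].
Proof.
move=> alt.
(* The side, in the band of strand [l], on which the arc of the smoothing [m] leaves a passage where
   an edge starts. *)
pose dir l : R := - (state_sign m * strand_sign l).
have dir2 l : dir l * dir l = 1.
  by rewrite /dir mulrNN mulrACA state_sign_sqr strand_sign_sqr mulr1.
(* The factor 1/2 keeps the tent invertible; edges that close up after one passage stay in place. *)
pose k y l : R := if next_time y l == tau y l + per (comp y l) then 0 else dir l / 2.
have k1 y l : `|k y l| < 1.
  rewrite /k; case: eqP => _; first by rewrite normr0.
  have d1 : `|dir l| = 1 by apply/eqP; rewrite -sqr_norm_eq1 expr2 dir2.
  by rewrite normrM d1 mul1r ger0_norm; lra.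
have [h [hh hV hid]] := push_edges k1; exists h; split => //.
- move=> y l t ne ht.
  have hp : edge_patch y l (t, 0).
    by move: ht => /andP[h1 h2]; split; rewrite /= ?normr0; [apply/andP; split|]; lra.
  have [hp' ->] := hV _ _ _ hp; apply: edge_patch_not_diagram => //.
  have kE : k y l = dir l / 2 by rewrite /k; case: eqP.
  rewrite /tent /= add0r normr0 subr0 kE; apply: mulf_neq0.
    by apply: mulf_neq0; [apply: contraTneq (oner_neq0 R) => e; rewrite -(dir2 l) e mul0r eqxx|lra].
  rewrite gt_eqF// lt_max; apply/orP; right; rewrite /edge_bump !lt_min.
  by move: ht => /andP[h1 h2]; apply/and3P; split; lra.
- move=> y p p1 p2 hs.
  have pn : p.1 != 0 /\ p.2 != 0.
    by split; apply: contraTneq hs => ->; rewrite ?mulr0 ?mul0r ?mulr0 ltxx.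
  have [[z [l [q hq e]]]|nV] := pselect (exists z l, (ribbon D (comp z l) @` edge_patch z l) (square y Over p)); last first.
    rewrite hid; first by apply: square_not_diagram; case: pn.
    by move=> z l hw; apply: nV; exists z, l.
  rewrite -e; have [hq' ->] := hV _ _ _ hq; apply: edge_patch_not_diagram => //.
  have [odd|/eqP ne] := eqVneq (next_time z l) (tau z l + per (comp z l)).
    rewrite /tent /k odd eqxx /= mul0r addr0; apply/eqP => q2; apply: (@square_not_diagram _ _ _ y Over p p1 p2 pn.1 pn.2).
    by rewrite -e; case: q q2 {hq hq' e} => t u /= ->; exists (comp z l), t.
  have kE : k z l = dir l / 2 by rewrite /k; case: eqP.
  rewrite kE; case: q hq hq' e => [t u] hq _ e /=.
  have u1 := edge_patch_strip hq; rewrite /= in u1.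
  have [n [a [a1 ho es _]]] := ribbon_in_square u1 p1 p2 e.
  have [z' [l' he]] := next_timeP z l.
  have lt_per : next_time z l < tau z l + per (comp z l).
    by rewrite lt_neqAle; apply/andP; split; [exact/eqP|have /andP[_] := edge_length he; lra].
  have l'E := alternating_edge alt he lt_per.
  have eo := edge_offset he (edge_patch_edge hq) a1 ho.
  (* At the far end both the offset [a] and, by alternation, the sign of the strand are reversed,
     which gives the same side. *)
  have du : 0 < dir l * u.
    case: eo => -[a0 _ _ nE]; rewrite -es nE ?l'E in hs.
      by rewrite -(pmulr_rgt0 _ a0) /dir; lra.
    have ol : strand_sign (other l) = - strand_sign l :> R by case: (l) => /=; rewrite ?opprK.
    by rewrite ol in hs; rewrite -(nmulr_rlt0 _ a0) /dir; lra.
  set M := Num.max 0 _; have M0 : 0 <= M by rewrite le_max lexx.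
  apply: contraTneq du => e0; rewrite -leNgt.
  have -> : dir l * u = - (dir l * dir l * M / 2).
    by have -> : u = - (dir l / 2 * M) by [lra|]; ring.
  by rewrite dir2; lra.
- move=> y p p1 p2; apply: hid => z l [[t u] hq e].
  have u1 := edge_patch_strip hq; rewrite /= in u1.
  have q1 : `|p.1| < 1 by lra.
  have q2 : `|p.2| < 1 by lra.
  have [n [a [a1 ho _ ea]]] := ribbon_in_square u1 q1 q2 e.
  have := edge_patch_off hq a1 ho; move: p1 p2.
  by case: ea => [[_ ->] /=|[_ [_ <-]]]; lra.
Qed.

End PushEdges.

(** * Pushing a smoothing arc across its crossing *)

Lemma open_embedding_comp (X Y Z : topologicalType) (V : set Y) (f : Y -> Z)
    (phi : X -> Y) (psi : Y -> X) : open_embedding V f ->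
  continuous phi -> continuous psi -> cancel phi psi -> cancel psi phi ->
  open_embedding (phi @^-1` V) (fun p => f (phi p)).
Proof.
move=> [cf fi fo] cphi cpsi hK Kh; split.
- apply: within_nbhsP => p W Vp nW.
  exact: (cphi p _ (within_nbhs cf Vp nW)).
- move=> p q; rewrite !inE => Vp Vq e; apply: (can_inj hK).
  by apply: fi; rewrite ?inE.
- move=> U Uo; have -> : (fun p => f (phi p)) @` (phi @^-1` V `&` U) = f @` (V `&` psi @^-1` U).
    apply/seteqP; split=> [_ [p [Vp Up] <-]|_ [q [Vq Uq] <-]].
      by exists (phi p) => //; split => //=; rewrite hK.
    by exists (psi q); rewrite ?Kh//; split => //=; rewrite Kh.
  by apply: fo; move/continuousP : cpsi; exact.
Qed.

Section PushCorner.
Variables (R : realType) (Sigma : oriented_surface R) (D : link_diagram Sigma).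
Implicit Types (i j : 'I_(ncomp D)) (s t u a : R) (x y z : crossing D) (l n : strand).

Local Notation off := (at_offset (period D) (passage D)).
Local Notation per := (period D).
Local Notation tau y l := (passage D y l).2.
Local Notation comp y l := (passage D y l).1.

Definition square_domain y l : set (R * R) :=
  [set p | `|p.1 - tau y l| < 1 /\ `|p.2| < 1].

Lemma square_domain_open y l : open (square_domain y l).
Proof. by apply: openI; apply: open_lt_cont; cont. Qed.

Lemma square_embedding y l : open_embedding (square_domain y l) (ribbon D (comp y l)).
Proof.
apply: ribbon_embedding; [exact: square_domain_open|by move=> p []|].
move=> [t u] [t' u'] [/= h1 h2] [/= h3 h4] e.
have := @square_inj _ _ _ y l (t - tau y l, u) (t' - tau y l, u') h1 h2 h3 h4.
rewrite /square /= ![tau y l + _]addrC !subrK => /(_ e) [h ->].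
by rewrite -(subrK (tau y l) t) h subrK.
Qed.

Variables (x : crossing D) (k1 k2 : R).
Hypotheses (k11 : k1 * k1 = 1) (k22 : k2 * k2 = 1).

(* In the coordinates p = (w, v), the smoothing arc in the quadrant of signs
   (k1, k2) is the segment v = 0, |w| <= 1/2, and the antidiagonal through the
   crossing is v = - 1/2. *)
Definition corner_coord (p : R * R) : R * R :=
  (k1 * ((2^-1 + p.2 + p.1) / 2), k2 * ((2^-1 + p.2 - p.1) / 2)).

Let phi (p : R * R) := (tau x Over + (corner_coord p).1, (corner_coord p).2).
Let psi (p : R * R) :=
  (k1 * (p.1 - tau x Over) - k2 * p.2, k1 * (p.1 - tau x Over) + k2 * p.2 - 2^-1).

Lemma corner_chart_embedding : open_embedding
  [set p | `|(corner_coord p).1| < 1 /\ `|(corner_coord p).2| < 1]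
  (fun p => square x Over (corner_coord p)).
Proof.
have aK (u v : R) : u + v - u = v by ring.
have -> : [set p | `|(corner_coord p).1| < 1 /\ `|(corner_coord p).2| < 1] =
    phi @^-1` square_domain x Over.
  by apply/seteqP; split=> p; rewrite /phi /square_domain /= aK.
apply: (open_embedding_comp (psi := psi) (square_embedding x Over)).
- by rewrite /phi /corner_coord; cont.
- by rewrite /psi; cont.
- move=> [a b]; rewrite /phi /psi /corner_coord /= aK !mulrA k11 k22 !mul1r.
  by congr pair; lra.
- move=> [a b]; rewrite /phi /psi /corner_coord /=; congr pair.
    rewrite (_ : _ / 2 = k1 * (a - tau x Over)); last by lra.
    by rewrite mulrA k11 mul1r addrC subrK.
  by rewrite (_ : _ / 2 = k2 * b) ?mulrA ?k22 ?mul1r//; lra.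
Qed.

Lemma corner_chart_open :
  open [set p | `|(corner_coord p).1| < 1 /\ `|(corner_coord p).2| < 1].
Proof. by apply: openI; apply: open_lt_cont; rewrite /corner_coord; cont. Qed.

(** With the factor -4/5 used in [push_corner], the height 5/8 moves the arc by exactly 1/2, onto
    the antidiagonal. The slope 5/2 brings the height down to 0 at [|w| = 3/4], which keeps the
    support inside the square. *)
Definition corner_bump (w : R) : R := 5 / 8 - 5 / 2 * Num.max 0 (`|w| - 2^-1).

Lemma corner_norm a b : `|k1 * a| = `|a| /\ `|k2 * b| = `|b|.
Proof.
by split; rewrite normrM; [have -> : `|k1| = 1|have -> : `|k2| = 1];
  rewrite ?mul1r//; apply/eqP; rewrite -sqr_norm_eq1 expr2 ?k11 ?k22.
Qed.

(** The third clause concerns the axes, which the push may displace too: [k1 * p.1] and [k2 * p.2]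
    decrease by the same amount, at most 1/4, so the one that vanishes becomes negative while the
    other, at least 1/2, stays positive. The point moves into an adjacent quadrant. *)
Lemma push_corner : exists h, [/\ homeomorphism h,
  forall w, `|w| <= 2^-1 ->
    h (square x Over (k1 * ((2^-1 + w) / 2), k2 * ((2^-1 - w) / 2))) =
    square x Over (k1 * (w / 2), k2 * (- w / 2)),
  forall p, `|p.1| < 1 -> `|p.2| < 1 -> p.1 * p.2 = 0 -> 2^-1 <= k1 * p.1 + k2 * p.2 ->
    h (square x Over p) = square x Over p \/ exists q, [/\ h (square x Over p) = square x Over q,
      `|q.1| < 1, `|q.2| < 1 & k1 * k2 * (q.1 * q.2) < 0] &
  forall w, (forall p, `|p.1| < 1 -> `|p.2| < 1 -> w <> square x Over p) -> h w = w].
Proof.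
have kk : `|- (4 / 5) : R| < 1 by rewrite normrN ger0_norm; lra.
have cb : continuous corner_bump by rewrite /corner_bump; cont.
have bnd p : `|p.2| <= corner_bump p.1 -> `|p.1| <= 3 / 4 /\ `|p.2| <= 5 / 8.
  rewrite /corner_bump; have [h1|h1] := leP (`|p.1| - 2^-1) 0; last first.
    by have := normr_ge0 p.2; split; lra.
  by rewrite mulr0 subr0; split; lra.
have [||h [hh hV hid]] := @chart_tent _ _ _ _ _ _ (@surface_hausdorff _ Sigma) corner_chart_open corner_chart_embedding kk cb.
- have c1 : compact (`[-1, 1]%classic `*` `[-1, 1]%classic : set (R * R)).
    by apply: compact_setX; exact: segment_compact.
  apply: subclosed_compact c1 _.
    apply: closed_le_cont; first by cont.
    by apply: (cont_comp cb); cont.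
  move=> p /bnd[]; rewrite !ler_norml => /andP[a1 a2] /andP[a3 a4].
  by split; rewrite /= in_itv /=; apply/andP; split; lra.
- move=> p /bnd[]; rewrite !ler_norml => /andP[a1 a2] /andP[a3 a4].
  rewrite /corner_coord /=; have [-> ->] := corner_norm ((2^-1 + p.2 + p.1) / 2) ((2^-1 + p.2 - p.1) / 2).
  by rewrite !ltr_norml; split; apply/andP; split; lra.
exists h; split => //.
- move=> w w1; have := hV (w, 0); rewrite /corner_coord /tent /= addr0 => hw.
  have [|_ ->] := hw.
    have [-> ->] := corner_norm ((2^-1 + w) / 2) ((2^-1 - w) / 2).
    by move: w1; rewrite ler_norml => /andP[w1 w2]; rewrite !ltr_norml; split; apply/andP; split; lra.
  rewrite normr0 subr0 add0r /corner_bump.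
  have -> : Num.max 0 (`|w| - 2^-1) = 0 by apply/max_idPl; lra.
  rewrite mulr0 subr0 (_ : Num.max 0 (5 / 8) = 5 / 8 :> R); last by apply/max_idPr; lra.
  by congr (square x Over (k1 * _, k2 * _)); lra.
- move=> p p1 p2 p0 pk.
  pose a := k1 * p.1; pose b := k2 * p.2.
  have [na nb] := corner_norm p.1 p.2; rewrite -/a in na; rewrite -/b in nb.
  have ep : corner_coord (a - b, a + b - 2^-1) = p.
    rewrite /corner_coord /= [RHS]surjective_pairing /a /b; congr pair.
      rewrite (_ : _ / 2 = k1 * p.1); last by lra.
      by rewrite mulrA k11 mul1r.
    rewrite (_ : _ / 2 = k2 * p.2); last by lra.
    by rewrite mulrA k22 mul1r.
  pose c := (a - b, a + b - 2^-1); have Vp : `|(corner_coord c).1| < 1 /\ `|(corner_coord c).2| < 1.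
    by rewrite ep.
  have [Vt] := hV c Vp; rewrite ep => ->.
  move: Vt; rewrite /tent /c /=; set M := Num.max 0 _.
  have M0 : 0 <= M by rewrite le_max lexx.
  have M1 : M <= 5 / 8.
    rewrite ge_max; apply/andP; split; first by lra.
    rewrite /corner_bump; set M' := Num.max 0 _; have M'0 : 0 <= M' by rewrite le_max lexx.
    by have := normr_ge0 (a + b - 2^-1); lra.
  have [->|Mn] := eqVneq M 0; first by rewrite mulr0 addr0 ep; left.
  have Mp : 0 < M by rewrite lt_neqAle eq_sym Mn.
  move=> [v1 v2]; right; eexists; split; [by []|by []|by []|].
  rewrite /corner_coord /=.
  set A := (_ / 2 : R); set B := (_ / 2 : R).
  have -> : k1 * k2 * (k1 * A * (k2 * B)) = A * B.
    by transitivity ((k1 * k1) * (k2 * k2) * (A * B)); [ring|rewrite k11 k22 !mul1r].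
  have eA : A = a - 2 / 5 * M by rewrite /A; lra.
  have eB : B = b - 2 / 5 * M by rewrite /B; lra.
  have ab : a * b = 0 by rewrite /a /b mulrACA p0 mulr0.
  have : a = 0 \/ b = 0.
    by move/eqP: ab; rewrite mulf_eq0 => /orP[]/eqP; [left|right].
  rewrite eA eB; case=> e; rewrite -/a -/b e ?add0r ?addr0 in pk *.
    by rewrite mulNr oppr_lt0 mulr_gt0//; lra.
  by rewrite mulrN oppr_lt0 mulr_gt0//; lra.
- by move=> w hw; apply: hid => -[p [c1 c2] e]; exact: (hw _ c1 c2 (esym e)).
Qed.

End PushCorner.

(** * Pushing a whole loop off the diagram *)

Section PushLoop.
Variables (R : realType) (Sigma : oriented_surface R) (D : link_diagram Sigma).
Implicit Types (i j : 'I_(ncomp D)) (s t u a : R) (x y z : crossing D) (l n : strand).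

Local Notation off := (at_offset (period D) (passage D)).
Local Notation per := (period D).
Local Notation tau y l := (passage D y l).2.
Local Notation comp y l := (passage D y l).1.
Local Notation diamond y := (crossing_chart y @` [set p | `|p.1| + `|p.2| < 2^-1]).

Lemma axis_outside_diamonds y p : `|p.1| < 1 -> `|p.2| < 1 -> p.1 * p.2 = 0 ->
  2^-1 <= `|p.1| + `|p.2| ->
  (diagram_curve D `\` \bigcup_(z in [set: crossing D]) diamond z) (square y Over p).
Proof.
move=> p1 p2 p0 ps; split; first exact/diagram_square.
move=> [z _ [q /= qs e]].
have q1 : `|q.1| < 1 by have := normr_ge0 q.2; lra.
have q2 : `|q.2| < 1 by have := normr_ge0 q.1; lra.
have [_ qp] := square_eq (l := Over) (m := Over) q1 q2 p1 p2 e.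
by case: qp ps => [[_ <-]|[]//]; lra.
Qed.

Lemma segment_or_free w :
  (diagram_curve D `\` \bigcup_(z in [set: crossing D]) diamond z) w ->
  (exists y l, segment y l w) \/ exists i, @free_circle _ _ D i w.
Proof.
rewrite diagram_minus_diamonds => -[[[y b] _ h]|[i _ h]]; [left|by right; exists i].
by exists y, (if b then Over else Under).
Qed.

Lemma free_circle_component i j t u w : free_circle i w -> `|u| < 1 ->
  w = ribbon D j (t, u) -> j = i.
Proof.
move=> [h [t' ->]] u1 /(ribbon_coincide (@norm0_lt1 R) u1)[[-> _ _]//|].
by move=> [y [l [a [_ [/h]]]]].
Qed.

(** A free circle is closed and disjoint from the closed union of the other pieces and the arcs at
    [x], so a connected part of the state curve cannot meet both. *)
Lemma free_circle_avoids (S : state D) x (L : set Sigma) i :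
  components (state_curve S) L -> L `&` smoothing_arcs x (S x) !=set0 ->
  L `&` free_circle i = set0.
Proof.
move=> hL [v [Lv av]]; apply/seteqP; split => // w [Lw fw].
have [h _] := fw.
pose F := \bigcup_(k in [set k | k <> inr i]) piece S x k `|` smoothing_arcs x (S x).
have Fc : closed F.
  apply: closedU; last exact: smoothing_arcs_closed.
  apply: closed_bigcup; first exact: finite_finset.
  by move=> k _; case: (piece_closed_connected S x k).
have sq_not y (q : R * R) v' : free_circle i v' -> `|q.2| < 1 -> v' <> square y Over q.
  by move=> fv q2 e; apply: (h y Over); rewrite (free_circle_component fv q2 e).
have fF v' : free_circle i v' -> ~ F v'.
  move=> fv [[[[[y b]|[y b]]|j] /= ki]|/smoothing_arcsP[q [q1 _ e]]].
  - case: eqP => // _ /quarterP[||q [q1 _ _ e]]; first exact: bsign_sqr.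
      by rewrite mulrACA mulrNN bsign_sqr state_sign_sqr mulr1.
    by apply: (sq_not _ _ _ fv _ e); apply: half_norm_lt1; have := normr_ge0 q.1; lra.
  - move=> [t _ e]; apply: (h y (if b then Over else Under)).
    by rewrite (free_circle_component fv (@norm0_lt1 R) (esym e)).
  - move=> [_ [t e]]; apply: ki; congr inr.
    exact: (free_circle_component fv (@norm0_lt1 R) e).
  - by apply: (sq_not _ _ _ fv _ e); apply: half_norm_lt1; have := normr_ge0 q.1; lra.
have fc : closed (free_circle i) by case: (free_circle_closed_connected i).
have LF : L `<=` ~` F.
  apply: (connected_split (components_connected hL) (closed_openC Fc) (closed_openC fc)).
  - move=> v' Lv'; have [Fv|nF] := pselect (F v'); last by left.
    by right => /fF.
  - apply/seteqP; split => // v' [[Lv' nF] nf].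
    have := components_sub hL Lv'; rewrite (state_curveE S x) => -[[k _ kv]|av'].
      have [ki|ki] := pselect (k = inr i); first by apply: nf; move: kv; rewrite ki.
      by apply: nF; left; exists k.
    by apply: nF; right.
  - by exists w; split => //; exact: fF.
by apply: (LF v Lv); right.
Qed.

(** Such a point is joined along its axis, outside the diamonds, to a corner of the quarter of signs
    [- k1], [- k2]; [L] would contain this corner. The factor [(2 * s)^-1] in the proof scales the
    point to the corner. *)
Lemma axis_opposite (S : state D) x (L : set Sigma) (k1 k2 : R) p :
  components (state_curve S) L -> k1 * k1 = 1 -> k2 * k2 = 1 ->
  quarter x (- k1) (- k2) `&` L = set0 ->
  `|p.1| < 1 -> `|p.2| < 1 -> p.1 * p.2 = 0 -> 2^-1 <= `|p.1| + `|p.2| ->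
  k1 * p.1 + k2 * p.2 < 0 -> ~ L (square x Over p).
Proof.
move=> hL k11 k22 qL p1 p2 p0 ps pk Lp.
set s := `|p.1| + `|p.2| in ps.
pose f t := ribbon D (comp x Over) (tau x Over + t * p.1, t * p.2).
have s0 : 0 < s by lra.
have r0 : 0 < (2 * s)^-1 by rewrite invr_gt0; lra.
have r1 : (2 * s)^-1 <= 1 by rewrite invf_le1; lra.
have nt t q : 0 <= t <= 1 -> `|q| < 1 -> `|t * q| < 1.
  by move=> /andP[t0 t1] q1; rewrite normrM (ger0_norm t0); have := normr_ge0 q; nra.
have t01 t : (2 * s)^-1 <= t <= 1 -> 0 <= t <= 1.
  by move=> /andP[h1 h2]; apply/andP; split; lra.
have sub : f @` `[(2 * s)^-1, 1] `<=` L.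
  apply: (components_absorb hL).
  - apply: (proj2 (@ribbon_path _ _ _ _ _ _ (fun t => (tau x Over + t * p.1, t * p.2)) _ _)).
      by cont.
    by move=> t /t01 t1 /=; exact: nt.
  - move=> v [t /=]; rewrite in_itv /= => ht <-; left.
    have t1 := t01 _ ht.
    apply: (@axis_outside_diamonds x (t * p.1, t * p.2)); rewrite /= ?nt//.
      by rewrite mulrACA p0 mulr0.
    case/andP: t1 => t0 _; rewrite !normrM (ger0_norm t0) -mulrDr -/s.
    case/andP: ht => h1 _; have := ler_wpM2r (ltW s0) h1.
    by rewrite invfM mulfVK ?gt_eqF.
  - exists (square x Over p); split => //; exists 1; last by rewrite /f !mul1r.
    by rewrite /= in_itv /= r1 lexx.
have : (quarter x (- k1) (- k2) `&` L) (f (2 * s)^-1).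
  split; last by apply: sub; exists (2 * s)^-1 => //; rewrite /= in_itv /= lexx r1.
  apply/quarterP; rewrite ?mulrNN//.
  exists ((2 * s)^-1 * p.1, (2 * s)^-1 * p.2); split => //=.
  - by rewrite !normrM (gtr0_norm r0) -mulrDr -/s invfM mulfVK ?gt_eqF.
  - rewrite mulrCA pmulr_rge0// mulNr oppr_ge0.
    move/eqP: p0; rewrite mulf_eq0 => /orP[/eqP e|/eqP e]; first by rewrite e mulr0.
    by move: pk; rewrite e mulr0 addr0 => /ltW.
  - rewrite mulrCA pmulr_rge0// mulNr oppr_ge0.
    move/eqP: p0; rewrite mulf_eq0 => /orP[/eqP e|/eqP e]; last by rewrite e mulr0.
    by move: pk; rewrite e mulr0 add0r => /ltW.
by rewrite qL.
Qed.

(** The corner push is applied first. What it displaces off the axes lands in the quadrants of the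
    arcs of [m], which the edge push keeps off the diagram; the arc at [x] lands at coordinates at
    most 1/4, where the edge push is the identity. As [L] avoids the opposite quarter, it meets the
    axes only on the half that [push_corner] controls. *)
Lemma push_loop (S : state D) (m : smoothing) x (L : set Sigma) (k1 k2 : R) :
  alternating D -> (forall y, y <> x -> S y = m) ->
  state_sign (S x) = - state_sign m :> R ->
  components (state_curve S) L -> bounds_disc R L ->
  k1 * k1 = 1 -> k2 * k2 = 1 -> k1 * k2 = state_sign m ->
  quarter x k1 k2 `<=` L -> quarter x (- k1) (- k2) `&` L = set0 ->
  exists h, [/\ homeomorphism h,
    (h @` L) `&` diagram_curve D = [set crossing_point x] &
    forall w, `|w| <= 2^-1 ->
      h (square x Over (k1 * ((2^-1 + w) / 2), k2 * ((2^-1 - w) / 2))) =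
      square x Over (k1 * (w / 2), k2 * (- w / 2))].
Proof.
move=> alt Sm Sx hL dL k11 k22 k12 qL nqL.
have [E [Eh E1 E2 E3]] := push_off_diagram m alt.
have [X [Xh X1 X2 X3]] := push_corner x k11 k22.
have n1 b : `|k1 * b| = `|b| by case: (corner_norm k11 k22 b 0).
have n2 b : `|k2 * b| = `|b| by case: (corner_norm k11 k22 0 b).
have EX w : `|w| <= 2^-1 ->
    E (X (square x Over (k1 * ((2^-1 + w) / 2), k2 * ((2^-1 - w) / 2)))) =
    square x Over (k1 * (w / 2), k2 * (- w / 2)).
  move=> w1; rewrite X1//; apply: E3; rewrite /= ?n1 ?n2 ?normrM ?normrN;
    by rewrite (@ger0_norm _ 2^-1); lra.
have mid : L (square x Over (k1 * ((2^-1 + 0) / 2), k2 * ((2^-1 - 0) / 2))).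
  apply: qL; apply/quarterP => //.
  exists (k1 * ((2^-1 + 0) / 2), k2 * ((2^-1 - 0) / 2)); split => //=.
  - by rewrite n1 n2 !ger0_norm; lra.
  - by rewrite mulrA k11 mul1r; lra.
  - by rewrite mulrA k22 mul1r; lra.
have cpE : E (X (square x Over (k1 * ((2^-1 + 0) / 2), k2 * ((2^-1 - 0) / 2)))) = crossing_point x.
  by rewrite EX ?normr0 ?invr_ge0// oppr0 !mul0r !mulr0.
have quarters w : smoothing_arcs x (S x) w -> L w -> quarter x k1 k2 w.
  rewrite smoothing_arcsE Sx opprK => hw Lw.
  have : k1 = 1 \/ k1 = -1.
    by apply/pred2P; rewrite -eqf_sqr expr2 k11 expr1n.
  case=> ek; rewrite ek ?mul1r ?mulN1r in k12 nqL *; rewrite ?opprK in nqL.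
    rewrite k12 in nqL *; case: hw => // hw.
    by have : (quarter x (-1) (- state_sign m) `&` L) w by []; rewrite nqL.
  have {}k12 : k2 = - state_sign m by rewrite -k12 opprK.
  rewrite k12 ?opprK in nqL *; case: hw => // hw.
  by have : (quarter x 1 (state_sign m) `&` L) w by []; rewrite nqL.
have arcL : L `&` smoothing_arcs x (S x) !=set0.
  exists (square x Over (k1 * ((2^-1 + 0) / 2), k2 * ((2^-1 - 0) / 2))); split => //.
  apply/smoothing_arcsP.
  exists (k1 * ((2^-1 + 0) / 2), k2 * ((2^-1 - 0) / 2)); split => //=.
    by rewrite n1 n2 !ger0_norm; lra.
  have e a b : - state_sign m * (k1 * a * (k2 * b)) = - (state_sign m * (k1 * k2) * (a * b)) by ring.
  by rewrite Sx e k12 state_sign_sqr mul1r oppr_le0; lra.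
have onD w : L w -> (diagram_curve D `\` \bigcup_(z in [set: crossing D]) diamond z) w ->
    ~ diagram_curve D (E (X w)).
  move=> Lw dw; have [[y [l sw]]|[i fw]] := segment_or_free dw; last first.
    by have := free_circle_avoids i hL arcL => e; have : (L `&` free_circle i) w by []; rewrite e.
  have odd : next_time y l <> tau y l + per (comp y l).
    move=> /(odd_segment_avoids hL dL) e.
    by have : (segment y l `&` L) w by []; rewrite e.
  have Ew : ~ diagram_curve D (E w).
    by case: sw => t; rewrite /= in_itv /= => ht <-; exact: E1.
  have [[p [p1 [p2 ew]]]|nsq] := pselect (exists p : R * R, `|p.1| < 1 /\ `|p.2| < 1 /\ w = square x Over p); last first.
    by rewrite X3// => p p1 p2 e; apply: nsq; exists p.
  have p0 : p.1 * p.2 = 0 by apply/(@diagram_square _ _ D x Over p p1 p2); rewrite -ew; case: dw.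
  have ps : 2^-1 <= `|p.1| + `|p.2|.
    by rewrite leNgt; apply/negP => h; case: dw => _; apply; exists x => //; exists p.
  have pk : 2^-1 <= `|k1 * p.1 + k2 * p.2|.
    apply: (le_trans ps); move/eqP: (p0); rewrite mulf_eq0 => /orP[]/eqP ->;
      by rewrite mulr0 normr0 ?addr0 ?add0r ?n1 ?n2.
  have pk' : 2^-1 <= k1 * p.1 + k2 * p.2.
    have [g0|g0] := leP 0 (k1 * p.1 + k2 * p.2); first by rewrite ger0_norm in pk.
    by case: (axis_opposite hL k11 k22 nqL p1 p2 p0 ps g0); rewrite -ew.
  rewrite ew; have [->|[q [-> q1 q2 qs]]] := X2 p p1 p2 p0 pk'; first by rewrite -ew.
  by apply: E2 => //; rewrite -k12.
exists (fun w => E (X w)); split => //; first exact: homeomorphism_comp.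
apply/seteqP; split=> [_ [[w Lw <-] Dw]|_ ->]; last first.
  split; first by rewrite -cpE; exists (square x Over (k1 * ((2^-1 + 0) / 2), k2 * ((2^-1 - 0) / 2))).
  by exists (comp x Over), (tau x Over + 0).
have [dw|[y _ aw]] := components_sub hL Lw; first by case: (onD w Lw dw).
have [yx|yx] := pselect (y = x).
  rewrite yx in aw; have [a] := quarters w aw Lw.
  rewrite /= in_itv /= => /andP[a0 a1] ew.
  have w1 : `|2 * a - 2^-1| <= 2^-1 by rewrite ler_norml; apply/andP; split; lra.
  have := EX _ w1.
  rewrite (_ : (2^-1 + _) / 2 = a); last by lra.
  rewrite (_ : (2^-1 - _) / 2 = 2^-1 - a); last by lra.
  rewrite ew => e; rewrite e in Dw *.
  set v := 2 * a - 2^-1 in w1 Dw *.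
  have : k1 * (v / 2) * (k2 * (- v / 2)) = 0.
    have hv : `|v / 2| < 1 by rewrite normrM (@ger0_norm _ 2^-1); lra.
    apply/(@diagram_square _ _ D x Over (k1 * (v / 2), k2 * (- v / 2))) => //=; first by rewrite n1.
    by rewrite n2 mulNr normrN.
  rewrite mulrACA k12 => /eqP; rewrite mulf_eq0; have [s0|_ /=] := eqVneq (state_sign m) (0 : R).
    by have /eqP := state_sign_sqr R m; rewrite s0 mul0r eq_sym oner_eq0.
  rewrite mulf_eq0 !mulf_eq0 oppr_eq0 invr_eq0 pnatr_eq0 /= !orbF orbb => /eqP ->.
  by rewrite oppr0 !mul0r !mulr0.
move: aw; rewrite (Sm _ yx) => /smoothing_arcsP[p [ps pm ew]].
have p1 : `|p.1| < 1 by apply: half_norm_lt1; have := normr_ge0 p.2; lra.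
have p2 : `|p.2| < 1 by apply: half_norm_lt1; have := normr_ge0 p.1; lra.
have [p0|p0] := eqVneq (p.1 * p.2) 0.
  by case: (onD w Lw) => //; rewrite ew; apply: axis_outside_diamonds; rewrite ?ps.
have s0 : state_sign m != 0 :> R.
  by apply/eqP => s0; have /eqP := state_sign_sqr R m; rewrite s0 mul0r eq_sym oner_eq0.
case: (E2 y p) => //; first by rewrite lt_neqAle pm mulf_neq0.
move: Dw; rewrite X3 ew // => q q1 q2 e.
by have [] := square_eq p1 p2 q1 q2 e.
Qed.

End PushLoop.

(** * Removable crossings *)

Section DiscLoop.
Variable R : realType.

Lemma circle_angle (b : R * R) : circle (0, 0) 1 b -> exists a, b = (cos a, sin a).
Proof.
case: b => b1 b2; rewrite /circle /= !subr0 expr1n => hb.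
have b11 : -1 <= b1 <= 1 by apply/andP; split; nra.
have e : Num.sqrt (1 - b1 ^+ 2) = `|b2| by rewrite -hb addrAC subrr add0r sqrtr_sqr.
have [b20|b20] := leP 0 b2.
  by exists (acos b1); rewrite acosK// sin_acos// e ger0_norm.
by exists (- acos b1); rewrite cosN sinN acosK// sin_acos// e ler0_norm ?opprK// ltW.
Qed.

Lemma cos_sin_inj (a b : R) : cos a = cos b -> sin a = sin b -> `|a - b| < pi *+ 2 -> a = b.
Proof.
wlog ab : a b / b <= a => [h|].
  have [|/ltW] := leP b a; first exact: h.
  by move=> ab ec es; rewrite distrC => lab; apply/esym/h.
move=> ec es; rewrite ger0_norm ?subr_ge0// => lab.
move: ab; rewrite le_eqVlt => /orP[/eqP //|ab]; exfalso.
have s0 : 0 < sin ((a - b) / 2).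
  by apply: sin_gt0_pi; apply/andP; split; move: lab; rewrite mulr2n; lra.
have c1 : cos (a - b) = 1 by rewrite cosB ec es -!expr2 cos2Dsin2.
have : cos (a - b) = 1 - sin ((a - b) / 2) ^+ 2 *+ 2.
  rewrite {1}[a - b]splitr cosD -!expr2 mulr2n.
  by have := cos2Dsin2 ((a - b) / 2); lra.
by rewrite c1; have := exprn_gt0 2 s0; rewrite mulr2n; lra.
Qed.

Lemma disc_loop (X : topologicalType) (L : set X) z : bounds_disc R L -> L z ->
  exists c : R -> X, [/\ simple_loop c, range c = L & c 0 = z].
Proof.
move=> [e [ce ei <- eo]] [b hb <-].
have [a0 eb] := circle_angle hb.
pose p (t : R) := (cos (a0 + pi *+ 2 * t), sin (a0 + pi *+ 2 * t)).
have pc t : circle (0, 0) 1 (p t).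
  by rewrite /circle /p /= !subr0 cos2Dsin2 expr1n.
have cd (q : R * R) : circle (0, 0) 1 q -> closed_disc (0, 0) 1 q.
  by rewrite /circle /closed_disc /= => ->.
have cp : continuous p by rewrite /p; cont.
have p0 : 0 < pi :> R := pi_gt0 R.
exists (fun t => e (p t)); split.
- split.
  + move=> t W nW; have := cp t _ (within_nbhs ce (cd _ (pc t)) nW).
    change (nbhs t [set t' | closed_disc (0, 0) 1 (p t') -> W (e (p t'))] ->
            nbhs t [set t' | W (e (p t'))]).
    by apply: filterS => t' /=; apply; exact: cd.
  + by move=> t; rewrite /p mulrDr mulr1 addrA cosD2pi sinD2pi.
  + move=> s t; rewrite !inE /= !in_itv /= => /andP[s0 s1] /andP[t0 t1].
    move=> /ei; rewrite !inE => /(_ (cd _ (pc s)) (cd _ (pc t))) [ec es].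
    have := cos_sin_inj ec es; rewrite opprD addrACA subrr add0r -mulrBr.
    move=> h; apply: (mulfI (x := pi *+ 2)); first by rewrite mulrn_eq0 /= gt_eqF.
    apply: (addrI a0); apply: h.
    rewrite normrM gtr0_norm; last by rewrite mulr2n; lra.
    rewrite gtr_pMr; last by rewrite mulr2n; lra.
    by rewrite ltr_norml; apply/andP; split; lra.
- apply/seteqP; split=> [_ [t _ <-]|_ [q hq <-]]; first by exists (p t).
  have [a ->] := circle_angle hq; exists ((a - a0) / (pi *+ 2)) => //.
  have pn : pi *+ 2 != 0 :> R by rewrite mulrn_eq0 /= gt_eqF.
  by rewrite /p (_ : a0 + _ = a)// [X in _ + X]mulrC divfK// addrC subrK.
- by rewrite /p mulr0 addr0 -eb.
Qed.

(** Injectivity on [0, 1) is moved to an interval centred at 0, the time when the loop passes the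
    crossing. *)
Lemma simple_loop_inj (X : topologicalType) (c : R -> X) s t : simple_loop c ->
  `|s| < 2^-1 -> `|t| < 2^-1 -> c s = c t -> s = t.
Proof.
move=> [_ cper ci]; rewrite !ltr_norml => /andP[s1 s2] /andP[t1 t2] e.
have inj u v : 0 <= u < 1 -> 0 <= v < 1 -> c u = c v -> u = v.
  by move=> hu hv; apply: ci; rewrite inE /= in_itv.
have [s0|s0] := leP 0 s; have [t0|t0] := leP 0 t.
- by apply: inj => //; apply/andP; split; lra.
- have : s = t + 1 by apply: inj; rewrite ?cper//; apply/andP; split; lra.
  by lra.
- have : s + 1 = t by apply: inj; rewrite ?cper//; apply/andP; split; lra.
  by lra.
- apply: (addIr 1); apply: inj; rewrite ?cper//; apply/andP; split; lra.
Qed.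

End DiscLoop.

Section Removable.
Variables (R : realType) (Sigma : oriented_surface R) (D : link_diagram Sigma).
Implicit Types (s t u a : R) (x y z : crossing D) (l n : strand).

Local Notation tau y l := (passage D y l).2.
Local Notation comp y l := (passage D y l).1.

Lemma square_connected y l : connected (ribbon D (comp y l) @` square_domain y l).
Proof.
set V := square_domain y l.
have -> : ribbon D (comp y l) @` V = \bigcup_(p in V)
    ((fun t => ribbon D (comp y l) (tau y l + t * (p.1 - tau y l), t * p.2)) @` `[0, 1]).
  apply/seteqP; split=> [_ [p Vp <-]|w [p [p1 p2] [t]]].
    exists p => //; exists 1; first by rewrite /= in_itv /= lexx ler01.
    by rewrite !mul1r addrC subrK -surjective_pairing.
  rewrite /= in_itv /= => /andP[t0 t1] <-.
  exists (tau y l + t * (p.1 - tau y l), t * p.2) => //.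
  rewrite /V /square_domain /= (_ : _ + _ - _ = t * (p.1 - tau y l)); last by ring.
  have g1 := normr_ge0 (p.1 - tau y l); have g2 := normr_ge0 p.2.
  by rewrite !normrM (ger0_norm t0); split; nra.
apply: bigcup_connected.
  exists (ribbon D (comp y l) (tau y l, 0)) => p Vp; exists 0; rewrite /= ?in_itv /= ?lexx ?ler01//.
  by rewrite !mul0r addr0.
move=> p [p1 p2].
apply: (proj2 (@ribbon_path _ _ _ _ 0 1 (fun t => (tau y l + t * (p.1 - tau y l), t * p.2)) _ _)).
  by cont.
by move=> t /andP[t0 t1] /=; rewrite normrM (ger0_norm t0); have := normr_ge0 p.2; nra.
Qed.

Lemma sign_exists (k : R) : k * k = 1 -> exists b : bool, k = (-1) ^+ b.
Proof.
move=> kk; have : k = 1 \/ k = -1 by apply/pred2P; rewrite -eqf_sqr expr2 kk expr1n.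
by case=> ->; [exists false|exists true]; rewrite ?expr0 ?expr1.
Qed.

Variables (S : state D) (x : crossing D) (L : set Sigma) (k1 k2 : R).
Hypotheses (hL : components (state_curve S) L) (k11 : k1 * k1 = 1) (k22 : k2 * k2 = 1).

Let arc w := square x Over (k1 * ((2^-1 + w) / 2), k2 * ((2^-1 - w) / 2)).

(** The bound 1/4 on [w] and [v] keeps the coordinates [A] and [B] positive. In the open quadrant
    the diagram is absent and smoothing arcs stay on the side of the diamond, which is [v = 0]. *)
Lemma loop_near_arc_middle : exists2 W, nbhs (arc 0) W &
  forall z : Sigma, L z -> W z -> exists2 w, `|w| < 1 / 4 & z = arc w.
Proof.
have fe := corner_chart_embedding x k11 k22.
have V0 : [set p | `|(corner_coord k1 k2 p).1| < 1 /\ `|(corner_coord k1 k2 p).2| < 1] ((0, 0) : R * R).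
  rewrite /corner_coord /=; have [-> ->] := corner_norm k11 k22 ((2^-1 + 0 + 0) / 2) ((2^-1 + 0 - 0) / 2).
  by split; rewrite ger0_norm; lra.
have n0 : nbhs ((0, 0) : R * R) [set p | `|p.1| < 1 / 4 /\ `|p.2| < 1 / 4].
  apply: open_nbhs_nbhs; split; last by rewrite /= normr0; split; lra.
  by apply: openI; apply: open_lt_cont; cont.
have := embedding_nbhs fe V0 n0.
have -> : square x Over (corner_coord k1 k2 (0, 0)) = arc 0.
  by rewrite /arc /corner_coord /= !addr0.
set W := (_ @` _) => nW; exists W => // z Lz [[w v] [/= _ [w1 v1]] ez].
exists w => //; move: w1 v1; rewrite !ltr_norml => /andP[w1 w2] /andP[v1 v2].
suff v0 : v = 0 by rewrite -ez v0 /arc /corner_coord /= addr0.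
move: ez; rewrite /corner_coord /=.
set A := (_ / 2 : R); set B := (_ / 2 : R) => ez.
have A0 : 0 < A by rewrite /A; lra.
have B0 : 0 < B by rewrite /B; lra.
have [nA nB] := corner_norm k11 k22 A B; rewrite (gtr0_norm A0) in nA; rewrite (gtr0_norm B0) in nB.
have A1 : `|k1 * A| < 1 by rewrite nA /A; lra.
have B1 : `|k2 * B| < 1 by rewrite nB /B; lra.
have kn : k1 != 0 /\ k2 != 0.
  by split; apply: contraTneq (oner_neq0 R) => e; [rewrite -k11 e|rewrite -k22 e];
    rewrite mul0r eqxx.
have [[dz _]|[y _ /smoothing_arcsP[q [qs _ eq]]]] := components_sub hL Lz.
  case: (@square_not_diagram _ _ D x Over (k1 * A, k2 * B)) => //=.
  - by apply: mulf_neq0; [case: kn|rewrite gt_eqF].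
  - by apply: mulf_neq0; [case: kn|rewrite gt_eqF].
  - by rewrite ez.
have q1 : `|q.1| < 1 by apply: half_norm_lt1; have := normr_ge0 q.2; lra.
have q2 : `|q.2| < 1 by apply: half_norm_lt1; have := normr_ge0 q.1; lra.
rewrite -ez in eq.
have [_ []] := @square_eq _ _ _ x Over (k1 * A, k2 * B) y Over q A1 B1 q1 q2 eq; last by case.
by move=> [_ qE]; move: qs; rewrite -qE /= nA nB /A /B; lra.
Qed.

(** The boundary of the disc is parametrized from the middle of the arc, which the push sends to the
    crossing. Near there the loop is [arc (w t)] with [w] continuous and injective, hence strictly
    monotone, so its image on the antidiagonal passes from one quadrant to the opposite one. *)
Lemma removable_crossing (m : smoothing) :
  alternating D -> (forall y, y <> x -> S y = m) ->
  state_sign (S x) = - state_sign m :> R -> bounds_disc R L ->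
  k1 * k2 = state_sign m ->
  quarter x k1 k2 `<=` L -> quarter x (- k1) (- k2) `&` L = set0 -> removable x.
Proof.
move=> alt Sm Sx dL k12 qL nqL.
have [h [hh hLD harc]] := push_loop alt Sm Sx hL dL k11 k22 k12 qL nqL.
have mid : L (arc 0).
  apply: qL; apply/quarterP => //.
  exists (k1 * ((2^-1 + 0) / 2), k2 * ((2^-1 - 0) / 2)); split => //=.
  - by have [-> ->] := corner_norm k11 k22 ((2^-1 + 0) / 2) ((2^-1 - 0) / 2); rewrite !ger0_norm; lra.
  - by rewrite mulrA k11 mul1r; lra.
  - by rewrite mulrA k22 mul1r; lra.
have [g [gl gL g0]] := disc_loop dL mid; have [gc gper gi] := gl.
have harc0 : h (arc 0) = crossing_point x.
  by rewrite harc ?normr0 ?invr_ge0// oppr0 !mul0r !mulr0.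
have rc : range (fun t => h (g t)) = h @` L.
  by rewrite -gL; apply/seteqP; split=> [_ [t _ <-]|_ [_ [t _ <-] <-]];
    [exists (g t) => //; exists t|exists t].
have dhL : bounds_disc R (h @` L) by exact: bounds_disc_homeomorphism.
exists (fun t => h (g t)); last by rewrite rc.
split.
- split.
  + by case: hh => hc _; exact: cont_comp.
  + by move=> t; rewrite gper.
  + by move=> s t hs ht /(homeomorphism_inj hh); exact: gi.
- rewrite rc; apply: (disc_separates (@surface_hausdorff _ Sigma) (V := square_domain x Over)
    (f := ribbon D (comp x Over)) (p0 := (tau x Over, 0)) dhL).
  + exact: square_domain_open.
  + by rewrite /square_domain /= subrr normr0.
  + exact: square_embedding.
  + exact: square_connected.
  + exists (arc 0) => //; rewrite harc0.
    by rewrite /crossing_point /crossing_chart /= addr0.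
- by rewrite rc hLD.
split; first by rewrite g0.
have [W nW WL] := loop_near_arc_middle.
have /nbhs_ballP[dw /= dw0 bd] : nbhs (0 : R) [set t | W (g t)].
  by apply: (gc 0); rewrite g0.
have [d dd0 d0] : exists2 d, d <= dw & 0 < d <= 1 / 4.
  exists (Num.min dw (1 / 4)); first by rewrite ge_min lexx.
  by rewrite lt_min dw0 /= ge_min lexx orbT andbT; lra.
have Lg t : L (g t) by rewrite -gL; exists t.
(* The position along the arc, with default value 0 when [t] is not close to 0. *)
have /boolp.choice[w wP] : forall t, exists w, `|t| < d -> `|w| < 1 / 4 /\ g t = arc w.
  move=> t; have [td|td] := ltP (`|t|) d; last by exists 0.
  have [w w1 e] : exists2 w, `|w| < 1 / 4 & g t = arc w.
    by apply: WL => //; apply: bd; rewrite /ball /= sub0r normrN; exact: lt_le_trans dd0.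
  by exists w.
have fe := corner_chart_embedding x k11 k22.
have dom u : `|u| < 1 / 4 ->
    [set p | `|(corner_coord k1 k2 p).1| < 1 /\ `|(corner_coord k1 k2 p).2| < 1] (u, 0).
  rewrite ltr_norml => /andP[u1 u2]; rewrite /corner_coord /=.
  have [-> ->] := corner_norm k11 k22 ((2^-1 + 0 + u) / 2) ((2^-1 + 0 - u) / 2).
  by rewrite !ltr_norml; split; apply/andP; split; lra.
have arcE u : arc u = square x Over (corner_coord k1 k2 (u, 0)).
  by rewrite /arc /corner_coord /= addr0.
have arc_inj u v : `|u| < 1 / 4 -> `|v| < 1 / 4 -> arc u = arc v -> u = v.
  move=> u1 v1; rewrite !arcE => e; case: fe => _ fi _.
  by have := fi (u, 0) (v, 0); rewrite !inE => /(_ (dom u u1) (dom v v1) e) [].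
have dn t : t \in `]- d, d[ -> `|t| < d by rewrite in_itv /= ltr_norml.
have w0 : w 0 = 0.
  have [w1 e] : `|w 0| < 1 / 4 /\ g 0 = arc (w 0) by apply: wP; rewrite normr0; case/andP: d0.
  by apply: arc_inj; rewrite ?normr0 -?e ?g0//; lra.
have wmono : {in `]- d, d[ &, {homo w : s t / s < t}} \/
    {in `]- d, d[ &, {homo w : s t /~ s < t}}.
  apply: itv_continuous_inj_mono.
    apply/subspace_continuousP => t /= /dn td N nN.
    have [w1 e] := wP t td.
    have nN' : nbhs (w t, 0 : R) [set p : R * R | N p.1].
      by apply: (@cont_fst _ _ _ id (@cont_id _) (w t, 0)).
    have [W' nW' WN] := embedding_nbhs_inj fe (dom _ w1) nN'.
    rewrite -arcE -e in nW'.
    change (nbhs t [set t' | t' \in `]- d, d[ -> N (w t')]).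
    have ng : nbhs t [set t' | W' (g t')] := gc t _ nW'.
    apply: filterS ng => t' /= Wt' /dn td'; have [w1' e'] := wP t' td'.
    by apply: (WN (w t', 0)); rewrite -?arcE -?e'//; exact: dom.
  move=> s t /dn sd /dn td e.
  have [_ es] := wP s sd; have [_ et] := wP t td.
  case/andP: d0 => _ d4.
  by apply: (simple_loop_inj gl); [lra|lra|rewrite es et e].
have [b1 e1] := sign_exists k11; have [b2 e2] := sign_exists k22.
(* [sg] is the sign of [w t]; the image has coordinates [k1 * (w t / 2)] and [k2 * (- w t / 2)], so
   this sign selects the quadrant. *)
have loc (c1 c2 : bool) t (sg : R) : `|t| < d -> sg * sg = 1 -> 0 < sg * w t ->
    (-1) ^+ c1 = sg * k1 -> (-1) ^+ c2 = - (sg * k2) -> local_region x c1 c2 (h (g t)).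
  move=> td sg2 sw ec1 ec2; have [w1 e] := wP t td.
  rewrite e harc; last by lra.
  exists (k1 * (w t / 2), k2 * (- w t / 2)) => //=; rewrite ec1 ec2.
  have -> : sg * k1 * (k1 * (w t / 2)) = sg * w t / 2.
    by transitivity (k1 * k1 * (sg * w t / 2)); [ring|rewrite k11 mul1r].
  have -> : - (sg * k2) * (k2 * (- w t / 2)) = sg * w t / 2.
    by transitivity (k2 * k2 * (sg * w t / 2)); [ring|rewrite k22 mul1r].
  have : sg * w t < 1 / 4.
    apply: le_lt_trans (ler_norm _) _; rewrite normrM.
    have -> : `|sg| = 1 by apply/eqP; rewrite -sqr_norm_eq1 expr2 sg2.
    by rewrite [ltLHS]mul1r.
  by move=> sw1; split; apply/andP; split; lra.
have in0 : 0 \in `]- d, d[ by rewrite in_itv /= oppr_lt0; case/andP: d0 => ->.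
have signN (b : bool) : (-1) ^+ (~~ b) = - (-1) ^+ b :> R by case: b => /=; rewrite ?expr0 ?expr1 ?opprK.
have tin t : - d < t < d -> t \in `]- d, d[ by rewrite in_itv.
have d00' : 0 < d by case/andP: d0.
(* The direction of the parametrization is unknown: if [w] decreases, the regions before and after
   the crossing are exchanged. *)
case: wmono => mono.
- exists (~~ b1), b2, d; split => // t /andP[t1 t2].
  + have td : t \in `]- d, d[ by apply: tin; apply/andP; split; lra.
    have wt : w t < 0 by rewrite -w0; apply: mono.
    by apply: (loc _ _ _ (-1)); rewrite ?dn// ?signN -?e1 -?e2; lra.
  + have td : t \in `]- d, d[ by apply: tin; apply/andP; split; lra.
    have wt : 0 < w t by rewrite -w0; apply: mono.
    by apply: (loc _ _ _ 1); rewrite ?dn// ?negbK ?signN -?e1 -?e2; lra.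
- exists b1, (~~ b2), d; split => // t /andP[t1 t2].
  + have td : t \in `]- d, d[ by apply: tin; apply/andP; split; lra.
    have wt : 0 < w t by rewrite -w0; apply: mono.
    by apply: (loc _ _ _ 1); rewrite ?dn// ?signN -?e1 -?e2; lra.
  + have td : t \in `]- d, d[ by apply: tin; apply/andP; split; lra.
    have wt : w t < 0 by rewrite -w0; apply: mono.
    by apply: (loc _ _ _ (-1)); rewrite ?dn// ?negbK ?signN -?e1 -?e2; lra.
Qed.

End Removable.

(** A variable [m] covers both kinds of adequacy: only the product of [state_sign m] with the signs
    of a quadrant matters. *)
Lemma reduced_alternating_adequate_at (R : realType) (Sigma : oriented_surface R)
    (D : link_diagram Sigma) (m : smoothing) :
  alternating D -> reduced D -> adequate_at (fun _ : crossing D => m).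
Proof.
move=> alt red S [x mS Sm].
have [le|nle] := pselect (contractible_loops S #<= contractible_loops (fun _ : crossing D => m))%card.
  by left.
right => -[H [_ Hhom _ HL]].
set S0 := (fun _ : crossing D => m) in nle HL.
have Sx : state_sign (S x) = - state_sign m :> R.
  by case: (S x) m mS {Sm HL nle S0} => [] [] //= _; rewrite ?opprK.
pose N (S' : state D) := [set K | loops S' K /\ K `&` smoothing_arcs x (S' x) !=set0].
have pieceE k : piece S x k = piece S0 x k.
  by case: k => [[[y b]|//]|//] /=; case: eqP => // yx; rewrite -Sm.
have arcs_closed n : closed (@smoothing_arcs _ _ D x n) by exact: smoothing_arcs_closed.
have avoid S1 S2 K : (forall k, piece S1 x k = piece S2 x k) ->
    (loops S1 `\` N S1) K -> (loops S2 `\` N S2) K.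
  move=> e [lK nK]; have [||lK2 nK2] := components_avoid (fun k => proj1 (piece_closed_connected S1 x k))
    (fun k => proj2 (piece_closed_connected S1 x k)) (state_curveE S1 x)
    (A' := state_curve S2) (Y' := smoothing_arcs x (S2 x)) _ (arcs_closed _) (arcs_closed _)
    (@piece_smoothing_arcs _ _ _ S1 x _ _) lK.
  - by rewrite (state_curveE S2 x); congr (_ `|` _); apply: eq_bigcupr => k _; rewrite e.
  - by apply/seteqP; split => // w hw; case: nK; split => //; exists w.
  - by split => // -[_]; rewrite nK2 => -[].
have eN : loops S `\` N S = loops S0 `\` N S0.
  by apply/seteqP; split=> K; apply: avoid.
pose arcs S' b := quarter x (bsign R b) (- bsign R b * state_sign ((S' : state D) x)).
have arcs_sqr S' b : - bsign R b * state_sign ((S' : state D) x) * (- bsign R b * state_sign (S' x)) = 1 :> R.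
  by rewrite mulrACA mulrNN bsign_sqr state_sign_sqr mulr1.
have arcsE S' : smoothing_arcs x ((S' : state D) x) = arcs S' true `|` arcs S' false.
  by rewrite smoothing_arcsE /arcs /= mulN1r opprK mul1r.
have arcs_cc S' b : closed (arcs S' b) /\ connected (arcs S' b).
  by apply: quarter_closed_connected; apply/eqP; rewrite -sqr_norm_eq1 expr2 arcs_sqr.
have arcs_sub S' b : arcs S' b `<=` state_curve S'.
  move=> w hw; rewrite (state_curveE S' x) arcsE; right.
  by case: b hw; [left|right].
have arcs_n0 S' b : arcs S' b !=set0.
  exists (square x Over (bsign R b * 0, - bsign R b * state_sign (S' x) * (2^-1 - 0))).
  by exists 0 => //=; rewrite in_itv /= lexx invr_ge0 ler0n.
have arcs_loop S' b : exists2 K, loops S' K & arcs S' b `<=` K.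
  have [w hw] := arcs_n0 S' b; have [K lK Kw] := components_cover (arcs_sub _ _ _ hw).
  exists K => //; apply: (components_absorb lK); [by case: (arcs_cc S' b)|exact: arcs_sub|].
  by exists w.
have fin (S' : state D) : finite_set (loops S').
  pose P (k : (crossing D * bool) + (crossing D * bool) + 'I_(ncomp D) + bool) :=
    match k with inl k' => piece S' x k' | inr b => arcs S' b end.
  apply: (@components_finite _ _ P).
  - by case=> [k|b] /=; [case: (piece_closed_connected S' x k)|case: (arcs_cc S' b)].
  - case=> [k|b] /=; last exact: arcs_sub.
    by rewrite (state_curveE S' x) => w hw; left; exists k.
  move=> w; rewrite (state_curveE S' x) => -[[k _ hk]|]; first by exists (inl k).
  by rewrite arcsE => -[hw|hw]; [exists (inr true)|exists (inr false)].
have [C1 lC1 aC1] := arcs_loop S true; have [C2 lC2 aC2] := arcs_loop S false.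
have N12 : N S `<=` [set C1; C2].
  move=> K [lK [w [Kw]]]; rewrite arcsE => -[aw|aw]; [left|right].
    by apply: (components_eq lK lC1); exists w; split => //; exact: aC1.
  by apply: (components_eq lK lC2); exists w; split => //; exact: aC2.
have N0n : loops S0 `&` N S0 !=set0.
  have [K lK aK] := arcs_loop S0 true; have [w hw] := arcs_n0 S0 true.
  by exists K; split => //; split => //; exists w; split; [exact: aK|rewrite arcsE; left].
have H1i : injective (H 1).
  by have [g [Hg _ _]] := Hhom 1; exact: can_inj Hg.
(* The final map of the isotopy is injective, so taking images under it is a bijection between the
   noncontractible loops of both states. *)
have hnc : (noncontractible_loops S #= noncontractible_loops S0)%card.
  rewrite card_eq_sym -HL; apply: inj_card_eq => K K' _ _ e.
  apply/seteqP; split=> w Kw.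
    by have : (H 1 @` K) (H 1 w) by [exists w|]; rewrite e => -[w' K'w /H1i <-].
  by have : (H 1 @` K') (H 1 w) by [exists w|]; rewrite -e => -[w' K'w /H1i <-].
have [C12 dC] := count_components (fin S0) eN N12 lC1 N0n hnc nle.
have disj K K' b' : loops S K -> loops S K' -> arcs S b' `<=` K' -> K <> K' ->
    arcs S b' `&` K = set0.
  move=> lK lK' aK' KK; apply/seteqP; split => // w [aw Kw]; case: KK.
  by apply: (components_eq lK lK'); exists w; split => //; exact: aK'.
have Sm' y : y <> x -> S y = m by move=> /Sm ->.
(* [K] runs along the arc [b] at [x] and not along the other one, which is the position required by
   [removable_crossing]; [k1] and [k2] are the signs of the quadrant of this arc. *)
have rem b K K' : loops S K -> loops S K' -> arcs S b `<=` K -> arcs S (~~ b) `<=` K' ->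
    K <> K' -> bounds_disc R K -> removable x.
  move=> lK lK' aK aK' KK dK.
  apply: (removable_crossing lK (k1 := bsign R b) (k2 := - bsign R b * state_sign (S x)) _ _ alt Sm' Sx dK) => //.
  - exact: bsign_sqr.
  - by rewrite Sx mulrNN mulrA bsign_sqr mul1r.
  - have := disj K K' (~~ b) lK lK' aK' KK.
    rewrite /arcs (_ : bsign R (~~ b) = - bsign R b) ?mulNr//.
    by case: (b); rewrite /= ?opprK.
case: dC => dC; apply: (red x).
  exact: (rem true C1 C2).
by apply: (rem false C2 C1) => //; exact/nesym.
Qed.

Theorem theorem12 (R : realType) (Sigma : oriented_surface R)
    (D : link_diagram Sigma) :
  alternating D -> reduced D -> adequate D.
Proof. by move=> alt red; split; exact: reduced_alternating_adequate_at. Qed.
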